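(* Let $T,V,\alpha,\Omega,G$ satisfy the Standing Assumption (G). Let $\mathcal U\subsetneqq\mathcal O\subseteq\mathbb{C}$ and let $(\varphi_\kappa)_{\kappa\in\mathcal O}$ be holomorphic functions $\varphi_\kappa:\Omega\to\mathbb{C}$ with $|\varphi_\kappa(z)|\le A(\kappa)e^{B(\kappa)|z|}$ for $z\in\Omega$, where $A(\kappa),B(\kappa)\ge0$ depend continuously on $\kappa$. Let $$F_n(z)=\sum_{l=0}^nC_l(n)\varphi_{\kappa_l(n)}(z),\qquad z\in\Omega,$$ with $C_l(n)\in\mathbb{C}$, $\kappa_l(n)\in\mathcal U$, and suppose that for some $\kappa\in\mathcal O\setminus\mathcal U$ and $C\ge0$, $$\lim_{n\to\infty}\sup_{z\in\Omega}|F_n(z)-\varphi_\kappa(z)|e^{-C|z|}=0.$$ Then $$\lim_{n\to\infty}\Psi(t,x;F_n)=\lim_{n\to\infty}\sum_{l=0}^nC_l(n)\Psi(t,x;\varphi_{\kappa_l(n)})=\Psi(t,x;\varphi_\kappa)$$ uniformly on compact subsets of $[0,T)\times\mathbb{R}$.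
   Context: Double sector: $S_\alpha:=\{0\}\cup\{z\ne0:\mathrm{Arg}(z)\in[0,\alpha]\cup[\pi,\pi+\alpha]\}$, $\mathrm{Arg}\in[0,2\pi)$. $\mathrm{AC}_{1,2}((0,T)\times\mathbb{R})$: functions $\Psi$ with $\Psi(\cdot,x)$ absolutely continuous on $(0,T)$ for all $x$ and $\Psi(t,\cdot),\partial_x\Psi(t,\cdot)$ absolutely continuous on $\mathbb{R}$ for all $t$. Standing Assumption (G): $T\in(0,\infty]$, $V:(0,T)\times\mathbb{R}\to\mathbb{C}$, $\alpha\in(0,\frac\pi2)$, $\Omega\supseteq S_\alpha$ open, $G:(0,T)\times\mathbb{R}\times\Omega\to\mathbb{C}$ holomorphic in $z$, such that: (i) for every $z\in S_\alpha$, $G(\cdot,\cdot,z)\in\mathrm{AC}_{1,2}$ and $i\partial_tG=(-\partial_x^2+V)G$ a.e.; (ii) there is an absolutely continuous $a:(0,T)\to(0,\infty)$ with $a(t)\to\infty$ as $t\to0^+$ such that $G(t,x,z)=e^{ia(t)(z-x)^2}\widetilde G(t,x,z)$ with $|\widetilde G(t,x,z)|\le A_0(t,x)e^{B_0(t,x)|z|}$ on $(0,T)\times\mathbb{R}\times\Omega$, $A_0,B_0\ge0$ continuous, and $A_0/\sqrt a$, $B_0$ extending continuously to $[0,T)\times\mathbb{R}$; (iii) $\lim_{t\to0^+}\widetilde G(t,x,z)/\sqrt{a(t)}=1/\sqrt{i\pi}$ for all $x,z$; (iv) $|\partial_x\widetilde G|,|\partial_x^2\widetilde G|,|\partial_t\widetilde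 G|\le A_1(t,x)e^{B_1(t,x)|z|}$ for $z\in S_\alpha$, with $A_1\ge0$ locally integrable and $B_1\ge0$ continuous. For $F$ holomorphic on $\Omega$ with an exponential bound $|F(z)|\le Ae^{B|z|}$, $\Psi(t,x;F):=\lim_{\varepsilon\to0^+}\int_{\mathbb{R}}e^{-\varepsilon y^2}G(t,x,y)F(y)dy$ for $t\in(0,T)$, and $\Psi(0,x;F):=F(x)$. *)

(* Defs.v *)
(* Complex numbers: the real-closed library's
   [complex R] (= R[i]), taken with its regular normed-module structure
   [(R[i])^o] so that topology / complex derivatives are available. *)
From HB Require Import structures.
From mathcomp Require Import all_boot all_order all_algebra.
From mathcomp Require Import all_classical all_reals all_analysis.
From mathcomp Require Export complex.
Set Implicit Arguments.
Unset Strict Implicit.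
Unset Printing Implicit Defensive.
Import Order.TTheory GRing.Theory Num.Theory.
Import numFieldNormedType.Exports.
Local Open Scope ring_scope.
Local Open Scope classical_set_scope.

Notation Cx R := ((complex R)^o).

Section Defs.
Context {R : realType}.
Local Notation C := (Cx R).
Local Notation mu := (@lebesgue_measure R).
Local Notation mu2 := ((@lebesgue_measure R) \x (@lebesgue_measure R))%E.

Definition cabs (z : C) : R := Normc.normc z.

Definition toC (x : R) : C := (x%:C)%C.

Definition reC (z : C) : R := @complex.Re R z.
Definition imC (z : C) : R := @complex.Im R z.

Definition cexp (w : C) : C :=
  toC (expR (reC w)) * ((cos (imC w)) +i* (sin (imC w)))%C.

Definition double_sector (alpha : R) : set C :=
  [set z | z = 0 \/ exists r theta : R, 0 < r /\
     ((0 <= theta <= alpha) \/ (pi <= theta <= pi + alpha)) /\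
     z = toC r * cexp ('i%C * toC theta)].

Definition abs_cont_on (a b : R) (f : R -> C) : Prop :=
  forall e : R, 0 < e -> exists d : R, 0 < d /\
    forall (n : nat) (u v : 'I_n -> R),
      (forall i, a <= u i /\ u i <= v i /\ v i <= b) ->
      (forall i j, i != j -> v i <= u j \/ v j <= u i) ->
      \sum_(i < n) (v i - u i) < d ->
      \sum_(i < n) cabs (f (v i) - f (u i)) < e.

Definition abs_cont (I : set R) (f : R -> C) : Prop :=
  forall a b : R, a <= b -> `[a, b] `<=` I -> abs_cont_on a b f.

Definition cderivable (f : R -> C) (x : R) : Prop :=
  derivable (fun y => reC (f y)) x 1 /\ derivable (fun y => imC (f y)) x 1.
Definition cderiv (f : R -> C) (x : R) : C :=
  ((fun y => reC (f y))^`() x +i* (fun y => imC (f y))^`() x)%C.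

Definition holo_on (Om : set C) (f : C -> C) : Prop :=
  forall z, Om z -> derivable f z 1.

Definition tint (T : \bar R) : set R := [set t | 0 < t /\ (t%:E < T)%E].
Definition dom (T : \bar R) : set (R * R) := [set p | tint T p.1].
Definition dom0 (T : \bar R) : set (R * R) :=
  [set p | 0 <= p.1 /\ (p.1%:E < T)%E].

Definition AC12 (T : \bar R) (Psi : R -> R -> C) : Prop :=
  (forall x : R, abs_cont (tint T) (fun t => Psi t x)) /\
  (forall t : R, tint T t ->
     abs_cont setT (Psi t) /\
     (forall x, cderivable (Psi t) x) /\
     abs_cont setT (cderiv (Psi t))).

Definition loc_integrable2 (D : set (R * R)) (f : R * R -> R) : Prop :=
  forall K : set (R * R), compact K -> K `<=` D ->
    mu2.-integrable K (fun p => (f p)%:E).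

Definition standing_G (T : \bar R) (V : R -> R -> C) (alpha : R)
    (Om : set C) (G : R -> R -> C -> C) : Prop :=
  (0 < T)%E /\ 0 < alpha /\ alpha < pi / 2 /\ open Om /\
  double_sector alpha `<=` Om /\
  (forall t x, tint T t -> holo_on Om (G t x)) /\
  (forall z, double_sector alpha z ->
     AC12 T (fun t x => G t x z) /\
     {ae mu2, forall p : R * R, dom T p ->
        [/\ cderivable (fun t => G t p.2 z) p.1,
            cderivable (cderiv (fun x => G p.1 x z)) p.2 &
            'i%C * cderiv (fun t => G t p.2 z) p.1 =
              - cderiv (cderiv (fun x => G p.1 x z)) p.2
              + V p.1 p.2 * G p.1 p.2 z]}) /\
  exists (a : R -> R) (Gt : R -> R -> C -> C) (A0 B0 A1 B1 : R -> R -> R),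
    abs_cont (tint T) (fun t => toC (a t)) /\
    (forall t, tint T t -> 0 < a t) /\
    a t @[t --> 0^'+] --> +oo /\
    (forall t x z, tint T t -> Om z ->
       G t x z = cexp ('i%C * toC (a t) * (z - toC x) ^+ 2) * Gt t x z /\
       cabs (Gt t x z) <= A0 t x * expR (B0 t x * cabs z)) /\
    (forall t x, tint T t -> 0 <= A0 t x /\ 0 <= B0 t x) /\
    {within dom T, continuous (fun p => A0 p.1 p.2)} /\
    {within dom T, continuous (fun p => B0 p.1 p.2)} /\
    (exists g : R * R -> R, {within dom0 T, continuous g} /\
       forall p, dom T p -> g p = A0 p.1 p.2 / Num.sqrt (a p.1)) /\
    (exists g : R * R -> R, {within dom0 T, continuous g} /\
       forall p, dom T p -> g p = B0 p.1 p.2) /\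
    (forall (x : R) (z : C), Om z ->
       Gt t x z / toC (Num.sqrt (a t)) @[t --> 0^'+] -->
         (1 / sqrtC ('i%C * toC pi) : C)) /\
    (forall t x z, tint T t -> double_sector alpha z ->
       (cderivable (fun y => Gt t y z) x ->
          cabs (cderiv (fun y => Gt t y z) x) <= A1 t x * expR (B1 t x * cabs z)) /\
       (cderivable (cderiv (fun y => Gt t y z)) x ->
          cabs (cderiv (cderiv (fun y => Gt t y z)) x)
            <= A1 t x * expR (B1 t x * cabs z)) /\
       (cderivable (fun s => Gt s x z) t ->
          cabs (cderiv (fun s => Gt s x z) t) <= A1 t x * expR (B1 t x * cabs z))) /\
    (forall t x, tint T t -> 0 <= A1 t x /\ 0 <= B1 t x) /\
    loc_integrable2 (dom T) (fun p => A1 p.1 p.2) /\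
    {within dom T, continuous (fun p => B1 p.1 p.2)}.

Definition Cint (f : R -> C) : C :=
  ((Rintegral mu setT (fun y => reC (f y)))
     +i* (Rintegral mu setT (fun y => imC (f y))))%C.

Definition Psi (G : R -> R -> C -> C) (F : C -> C) (t x : R) : C :=
  if t == 0 then F (toC x)
  else lim ((fun eps : R =>
         Cint (fun y => toC (expR (- eps * y ^+ 2)) * G t x (toC y) * F (toC y)))
         @ 0^'+).

Definition Fseq (Cf kap : nat -> nat -> C) (phi : C -> C -> C) (n : nat)
    (z : C) : C :=
  \sum_(l < n.+1) Cf n l * phi (kap n l) z.

Definition unif_cvg_on (K : set (R * R)) (f : nat -> R * R -> C)
    (g : R * R -> C) : Prop :=
  forall e : R, 0 < e ->
    \forall n \near \oo, forall p, K p -> cabs (f n p - g p) < e.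

End Defs.

(* Main.v *)
Require Import Defs.
From HB Require Import structures.
From mathcomp Require Import all_boot all_order all_algebra.
From mathcomp Require Import all_classical all_reals all_analysis.
From mathcomp Require Import complex.
From mathcomp Require Import measurable_realfun ring lra.
Import Order.TTheory GRing.Theory Num.Theory.
Import numFieldNormedType.Exports.
Local Open Scope ring_scope.
Local Open Scope classical_set_scope.

(** For [|x| <= X] rotate the contour [R] about the point [x] itself, onto the
    line [u + i c (u - x)].  When the slope [c > 0] is small (depending on [X]),
    this line and all the intermediate ones stay in [Om]: far from the origin
    they lie in the double sector, and on a bounded range of [u] they lie in a
    strip around the real axis contained in the open set [Om].  On the rotated
    line [|exp(i a (z - x)^2)| = exp(-2 a c (u - x)^2)], so the regularization
    can be removed by dominated convergence: [Psi G F t x] is an absolutely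
    convergent integral, linear in [F].  If [|F z| <= e exp(C |z|)] on [Om],
    this Gaussian gives [|Psi G F t x| <= e K(X) A0 / sqrt(a)], which is bounded
    up to [t = 0] because [A0 / sqrt a] and [B0] extend continuously and [a] is
    bounded below on compact sets.  Applying this to [Fseq n - phi kappa] gives
    both limits. *)

(** * Complex moduli and complex differentiability *)

Section ComplexBasics.
Context {R : realType}.
Implicit Types z w : Cx R.

(** The centre of rotation matters. On a line [z = u (1 + i c)] through the origin, [|exp(i a (z -
    x)^2)| = exp(- 2 a c (u - x/2)^2 + a c x^2 / 2)], and the part [exp(a c x^2 / 2)] explodes when
    [a] tends to infinity at [t = 0]. Rotation about [x] leaves no cross term, so the Gaussian
    integral is exactly of order [1 / sqrt(a)], the factor that compensates the growth of [A0]. The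
    price is that the line leaves the double sector for [u] between [0] and [x]; there the openness
    of [Om] must help, and this ties the slope to [X].

    Two different decays are used. While the contour turns, the chirp is of no help, since it has
    modulus 1 on the real axis; for fixed [e > 0] the decay comes from [exp(- e z^2)], uniformly in
    the angle. Once the line is rotated, the chirp decays uniformly in [e], and [e] can tend to 0.

    Complex differentiability is available only pointwise, without continuity of the derivative, so
    the invariance under rotation rests on a bisection argument of Goursat type. *)

Lemma complexP z w : reC z = reC w -> imC z = imC w -> z = w.
Proof. by case: z w => a b [c d] /= -> ->. Qed.

Lemma reCD z w : reC (z + w) = reC z + reC w. Proof. by case: z w => a b []. Qed.
Lemma imCD z w : imC (z + w) = imC z + imC w. Proof. by case: z w => a b []. Qed.
Lemma reCN z : reC (- z) = - reC z. Proof. by case: z. Qed.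
Lemma imCN z : imC (- z) = - imC z. Proof. by case: z. Qed.
Lemma reCM z w : reC (z * w) = reC z * reC w - imC z * imC w.
Proof. by case: z w => a b []. Qed.
Lemma imCM z w : imC (z * w) = reC z * imC w + imC z * reC w.
Proof. by case: z w => a b []. Qed.
Lemma reC_toC (r : R) : reC (toC r) = r. Proof. by []. Qed.
Lemma imC_toC (r : R) : imC (toC r) = 0. Proof. by []. Qed.

Definition reimE := (reCD, imCD, reCN, imCN, reCM, imCM, reC_toC, imC_toC).

Lemma cabsE z : cabs z = Num.sqrt (reC z ^+ 2 + imC z ^+ 2).
Proof. by case: z. Qed.

Lemma normC_cabs z : `|z| = toC (cabs z).
Proof. by rewrite normc_def cabsE. Qed.

Lemma cabs_ge0 z : 0 <= cabs z. Proof. by rewrite cabsE sqrtr_ge0. Qed.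
Lemma cabs0 : cabs (0 : Cx R) = 0. Proof. exact: Normc.normc0. Qed.
Lemma cabsM z w : cabs (z * w) = cabs z * cabs w.
Proof. exact: Normc.normcM. Qed.
Lemma cabsN z : cabs (- z) = cabs z. Proof. exact: normcN. Qed.
Lemma le_cabsD z w : cabs (z + w) <= cabs z + cabs w.
Proof. exact: le_normcD. Qed.
Lemma cabs_toC (r : R) : cabs (toC r) = `|r|.
Proof. by rewrite cabsE /= expr0n addr0 sqrtr_sqr. Qed.
Lemma cabs_sqr z : cabs z ^+ 2 = reC z ^+ 2 + imC z ^+ 2.
Proof. by rewrite cabsE sqr_sqrtr// addr_ge0 ?sqr_ge0. Qed.

Lemma le_reC_cabs z : `|reC z| <= cabs z.
Proof. by rewrite cabsE -sqrtr_sqr ler_wsqrtr// lerDl sqr_ge0. Qed.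
Lemma le_imC_cabs z : `|imC z| <= cabs z.
Proof. by rewrite cabsE -sqrtr_sqr ler_wsqrtr// lerDr sqr_ge0. Qed.
Lemma cabs_le_reim z : cabs z <= `|reC z| + `|imC z|.
Proof.
rewrite -(@ler_pXn2r _ 2)// ?nnegrE ?addr_ge0 ?cabs_ge0 ?normr_ge0//.
rewrite cabs_sqr -[reC z ^+ 2]real_normK ?num_real// -[imC z ^+ 2]real_normK ?num_real//.
by have := mulr_ge0 (normr_ge0 (reC z)) (normr_ge0 (imC z)); nra.
Qed.

(** In [R[i]] the order relates only numbers with equal imaginary parts, so a complex radius [e > 0]
    is a positive real number. This is the passage between library limits and real epsilons. *)
Lemma cvgC (I : Type) (F : set_system I) (FF : Filter F) (f : I -> Cx R) (l : Cx R) :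
  (forall e : R, 0 < e -> \forall x \near F, cabs (l - f x) < e) <->
  f @ F --> l.
Proof.
split=> [H|/cvgrPdist_lt H e e0].
  apply/cvgrPdist_lt => e; rewrite ltcE /= => /andP[/eqP e0i e0].
  have := H _ e0; apply: filterS => x hx.
  by rewrite normC_cabs ltcE /= hx eq_sym e0i eqxx.
have e0' : 0 < toC e by rewrite ltcE /= eqxx e0.
by have := H _ e0'; apply: filterS => x; rewrite normC_cabs ltcR.
Qed.

Lemma cvgC_reim (I : Type) (F : set_system I) (FF : Filter F) (f : I -> Cx R) (l : Cx R) :
  (fun x => reC (f x)) @ F --> reC l -> (fun x => imC (f x)) @ F --> imC l ->
  f @ F --> l.
Proof.
move=> /cvgrPdist_lt fr /cvgrPdist_lt fi; apply/cvgC => e e0.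
have e2 : 0 < e / 2 by rewrite divr_gt0.
apply: filterS2 (fr _ e2) (fi _ e2) => x hr hi.
apply: le_lt_trans (cabs_le_reim _) _; rewrite !reimE.
by rewrite (splitr e) ltrD.
Qed.

(** [derivable f z0 1] with real moduli: the library norm on [Cx R] is itself
    complex-valued. *)
Definition cdiff (f : Cx R -> Cx R) z0 := exists b : Cx R, forall e : R, 0 < e ->
  exists2 d : R, 0 < d & forall z, cabs (z - z0) < d ->
    cabs (f z - f z0 - b * (z - z0)) <= e * cabs (z - z0).

Lemma derivable_cdiff f z0 : derivable f z0 1 -> cdiff f z0.
Proof.
move=> /cvg_ex[b /cvgC H]; exists b => e e0.
have [d/=] := H _ e0.
rewrite ltcE /= => /andP[/eqP d0i d0] hd.
exists (complex.Re d) => // z zd.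
have [->|zz0] := eqVneq z z0; first by rewrite !subrr mulr0 subr0 cabs0 mulr0.
have h0 : z - z0 != 0 by rewrite subr_eq0.
have := hd (z - z0); rewrite /= sub0r normrN normC_cabs ltcE /= zd -d0i eqxx.
move=> /(_ isT h0) /ltW.
rewrite [_%:A]mulr1 subrK [_ *: _]/( _ * _) => hle.
have -> : f z - f z0 - b * (z - z0) = - ((b - (z - z0)^-1 * (f z - f z0)) * (z - z0)).
  rewrite mulrBl mulrAC mulVf// mul1r; ring.
by rewrite cabsN cabsM ler_wpM2r ?cabs_ge0.
Qed.

Lemma cdiff_derivable f z0 : cdiff f z0 -> derivable f z0 1.
Proof.
move=> [b H]; apply/cvg_ex; exists b; apply/cvgC => e e0.
have [|d d0 hd] := H (e / 2); first by rewrite divr_gt0.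
exists (toC d); first by rewrite /= ltcE /= eqxx d0.
move=> h /=; rewrite sub0r normrN normC_cabs ltcR => hlt h0.
have := hd (z0 + h); rewrite addrAC subrr add0r => /(_ hlt) hle.
rewrite [_%:A]mulr1 [_ *: _]/( _ * _).
have -> : b - h^-1 * (f (h + z0) - f z0) = - ((f (z0 + h) - f z0 - b * h) * h^-1).
  rewrite !mulrBl -(mulrA b) divff// (addrC h); ring.
rewrite cabsN cabsM -[cabs h^-1]/(Normc.normc _) Normc.normcV.
have hp : 0 < cabs h.
  by rewrite lt_neqAle cabs_ge0 andbT eq_sym; apply: contra_neq h0; exact: Normc.eq0_normc.
rewrite ltr_pdivrMr//; apply: le_lt_trans hle _.
by rewrite ltr_pM2r// ltr_pdivrMr// ltr_pMr// ltrDl.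
Qed.

End ComplexBasics.

(** * Integrals of complex-valued functions *)

Section Bisection.
Context {R : realType}.

Lemma nested_intervals (a b : nat -> R) :
  {homo a : m n / (m <= n)%N >-> m <= n} -> {homo b : m n / (m <= n)%N >-> n <= m} ->
  (forall n, a n <= b n) -> exists p, forall n, a n <= p <= b n.
Proof.
move=> ha hb hab; have ub n : ubound (range a) (b n).
  move=> _ [m _ <-]; rewrite (le_trans (ha m (maxn m n) _)) ?leq_maxl//.
  by rewrite (le_trans (hab _))// hb// leq_maxr.
exists (sup (range a)) => n; apply/andP; split.
  by apply: ub_le_sup; [exists (b 0%N)|exists n].
by apply: ge_sup; [exists (a 0%N); exists 0%N|].
Qed.

(** [P n a s] is meant to speak of the rectangle with lower left corner [(a, s)] and sides
    [W1 / 2 ^+ n], [W2 / 2 ^+ n]. The two booleans select one of its four quarters, and [(p, q)] is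
    the common point of the selected rectangles. *)
Lemma dyadic_bisection (W1 W2 : R) (P : nat -> R -> R -> Prop) (a s : R) :
  0 <= W1 -> 0 <= W2 ->
  (forall n a s, P n a s -> exists ij : bool * bool,
     P n.+1 (a + ij.1%:R * (W1 / 2 ^+ n.+1)) (s + ij.2%:R * (W2 / 2 ^+ n.+1))) ->
  P 0%N a s ->
  exists p q, forall n, exists a' s', [/\ P n a' s',
    a' <= p <= a' + W1 / 2 ^+ n & s' <= q <= s' + W2 / 2 ^+ n].
Proof.
move=> W10 W20 step P0.
(* The selection becomes a total function of the triple (level, corner); where [P] fails,
   [(false, false)] is a dummy value that the iteration never meets. *)
have /choice[F HF] (x : nat * R * R) : exists ij : bool * bool,
    P x.1.1 x.1.2 x.2 -> P x.1.1.+1 (x.1.2 + ij.1%:R * (W1 / 2 ^+ x.1.1.+1))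
      (x.2 + ij.2%:R * (W2 / 2 ^+ x.1.1.+1)).
  case: (pselect (P x.1.1 x.1.2 x.2)) => [/step[ij Hij]|nP]; first by exists ij.
  by exists (false, false).
pose nx (x : nat * R * R) := (x.1.1.+1, x.1.2 + (F x).1%:R * (W1 / 2 ^+ x.1.1.+1),
      x.2 + (F x).2%:R * (W2 / 2 ^+ x.1.1.+1)).
pose x n := iter n nx (0%N, a, s).
have xn n : (x n).1.1 = n by elim: n => //= n ->.
have Px n : P n (x n).1.2 (x n).2.
  by elim: n => //= n /[dup] IH; rewrite -{1}[in P n](xn n) => /HF; rewrite xn.
have half (W : R) n : W / 2 ^+ n = W / 2 ^+ n.+1 + W / 2 ^+ n.+1.
  by rewrite exprS; field; rewrite expf_neq0.
have pos (W : R) n : 0 <= W -> 0 <= W / 2 ^+ n by move=> ?; rewrite divr_ge0// exprn_ge0.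
have b01 (b : bool) (w : R) : 0 <= w -> 0 <= b%:R * w <= w.
  by case: b => w0; rewrite ?mul1r ?mul0r w0 lexx.
have [p Hp] : exists p, forall n, (x n).1.2 <= p <= (x n).1.2 + W1 / 2 ^+ n.
  apply: nested_intervals => [||n]; last by rewrite lerDl pos.
    apply: (homo_leq (r := fun u v => u <= v)); [exact: lexx|by move=> ? ? ?; apply: le_trans|move=> n /=].
    by rewrite xn lerDl; case/andP: (b01 (F (x n)).1 _ (pos _ n.+1 W10)).
  apply: (homo_leq (r := fun u v => v <= u)); [exact: lexx|by move=> ? ? ? /[swap]; apply: le_trans|move=> n /=].
  rewrite xn (half _ n) -addrA lerD2l lerD2r.
  by case/andP: (b01 (F (x n)).1 _ (pos _ n.+1 W10)).
have [q Hq] : exists p, forall n, (x n).2 <= p <= (x n).2 + W2 / 2 ^+ n.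
  apply: nested_intervals => [||n]; last by rewrite lerDl pos.
    apply: (homo_leq (r := fun u v => u <= v)); [exact: lexx|by move=> ? ? ?; apply: le_trans|move=> n /=].
    by rewrite xn lerDl; case/andP: (b01 (F (x n)).2 _ (pos _ n.+1 W20)).
  apply: (homo_leq (r := fun u v => v <= u)); [exact: lexx|by move=> ? ? ? /[swap]; apply: le_trans|move=> n /=].
  rewrite xn (half _ n) -addrA lerD2l lerD2r.
  by case/andP: (b01 (F (x n)).2 _ (pos _ n.+1 W20)).
by exists p, q => n; exists (x n).1.2, (x n).2.
Qed.

End Bisection.

(** * Integration of complex-valued functions of a real variable *)

Section ComplexIntegral.
Context {R : realType}.
Local Notation mu := (@lebesgue_measure R).
Implicit Types (D : set R) (f g : R -> Cx R).

(** [Cint] is convertible to the case [D = setT]. *)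
Definition Cintegral D f : Cx R :=
  ((\int[mu]_(x in D) reC (f x)) +i* (\int[mu]_(x in D) imC (f x)))%C.

Definition Cintegrable D f :=
  mu.-integrable D (EFin \o (fun x => reC (f x))) /\
  mu.-integrable D (EFin \o (fun x => imC (f x))).

Lemma eq_Cintegral D f g : (forall x, D x -> f x = g x) -> Cintegral D f = Cintegral D g.
Proof.
by move=> fg; apply: complexP => /=; apply: eq_Rintegral => x /set_mem Dx;
  rewrite fg.
Qed.

Lemma CintegrableZ D f k : measurable (D : set (measurableTypeR R)) -> Cintegrable D f ->
  Cintegrable D (fun x => k * f x).
Proof.
move=> mD [fr fi]; split.
- have := integrableB mD (integrableZl mD (reC k) fr) (integrableZl mD (imC k) fi).
  by apply: eq_integrable => // x _ /=; rewrite reCM.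
- have := integrableD mD (integrableZl mD (reC k) fi) (integrableZl mD (imC k) fr).
  by apply: eq_integrable => // x _ /=; rewrite imCM.
Qed.

Lemma CintegralD D f g : measurable (D : set (measurableTypeR R)) -> Cintegrable D f -> Cintegrable D g ->
  Cintegral D (fun x => f x + g x) = Cintegral D f + Cintegral D g.
Proof.
move=> mD [fr fi] [gr gi]; apply: complexP => /=.
- by rewrite -RintegralD//; apply: eq_Rintegral => x _; rewrite reCD.
- by rewrite -RintegralD//; apply: eq_Rintegral => x _; rewrite imCD.
Qed.

Lemma CintegralZ D f k : measurable (D : set (measurableTypeR R)) -> Cintegrable D f ->
  Cintegral D (fun x => k * f x) = k * Cintegral D f.
Proof.
move=> mD [fr fi]; apply: complexP; rewrite ?(reCM, imCM)/=.
- rewrite -!RintegralZl// -RintegralB//; last 2 first.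
  + exact: integrableZl fr.
  + exact: integrableZl fi.
  by apply: eq_Rintegral => x _; rewrite reCM.
- rewrite -!RintegralZl// -RintegralD//; last 2 first.
  + exact: integrableZl fi.
  + exact: integrableZl fr.
  by apply: eq_Rintegral => x _; rewrite imCM.
Qed.

Lemma Cintegrable_dominated D f (g : R -> R) : measurable (D : set (measurableTypeR R)) ->
  measurable_fun D (fun x => reC (f x)) -> measurable_fun D (fun x => imC (f x)) ->
  mu.-integrable D (EFin \o g) -> (forall x, D x -> cabs (f x) <= g x) ->
  Cintegrable D f.
Proof.
move=> mD mr mi ig fg; split; apply: (le_integrable mD _ _ ig).
- exact/measurable_EFinP.
- move=> x Dx /=; rewrite lee_fin (le_trans (le_reC_cabs _))//.
  by rewrite (le_trans (fg _ Dx))// ler_norm.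
- exact/measurable_EFinP.
- move=> x Dx /=; rewrite lee_fin (le_trans (le_imC_cabs _))//.
  by rewrite (le_trans (fg _ Dx))// ler_norm.
Qed.

(** The factor 2 comes from bounding real and imaginary parts separately. *)
Lemma le_cabs_Cintegral D f (g : R -> R) : measurable (D : set (measurableTypeR R)) -> Cintegrable D f ->
  mu.-integrable D (EFin \o g) -> (forall x, D x -> cabs (f x) <= g x) ->
  cabs (Cintegral D f) <= 2 * \int[mu]_(x in D) g x.
Proof.
move=> mD [fr fi] ig fg; apply: le_trans (cabs_le_reim _) _.
rewrite mulr_natl mulr2n lerD//=.
- apply: le_trans (le_normr_Rintegral mD fr) _.
  apply: le_Rintegral => //; first exact: (integrable_norm fr).
  by move=> x Dx; apply: le_trans (fg _ Dx); exact: le_reC_cabs.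
- apply: le_trans (le_normr_Rintegral mD fi) _.
  apply: le_Rintegral => //; first exact: (integrable_norm fi).
  by move=> x Dx; apply: le_trans (fg _ Dx); exact: le_imC_cabs.
Qed.

Lemma continuous_reC : continuous (@reC R).
Proof.
move=> z; apply/(@cvgrPdist_lt _ _ _ (nbhs z)) => e e0.
have /(cvgC _)/(_ e e0) : (id @ z --> z) by exact: cvg_id.
by apply: filterS => y; apply: le_lt_trans; rewrite -reCN -reCD le_reC_cabs.
Qed.

Lemma continuous_imC : continuous (@imC R).
Proof.
move=> z; apply/(@cvgrPdist_lt _ _ _ (nbhs z)) => e e0.
have /(cvgC _)/(_ e e0) : (id @ z --> z) by exact: cvg_id.
by apply: filterS => y; apply: le_lt_trans; rewrite -imCN -imCD le_imC_cabs.
Qed.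

Lemma Cintegrable_itv (a b : R) f :
  (forall x, a <= x <= b -> {for x, continuous f}) -> Cintegrable `[a, b] f.
Proof.
move=> cf; split; apply: continuous_compact_integrable;
  [exact: segment_compact| |exact: segment_compact|];
  apply: continuous_in_subspaceT => x /set_mem /= => xab.
- by apply: (@continuous_comp _ _ _ f (@reC R)); [exact/cf|exact: continuous_reC].
- by apply: (@continuous_comp _ _ _ f (@imC R)); [exact/cf|exact: continuous_imC].
Qed.

Lemma Cintegral_itv_split (a b c : R) f : a <= b <= c -> Cintegrable `[a, c] f ->
  Cintegral `[a, c] f = Cintegral `[a, b] f + Cintegral `[b, c] f.
Proof.
move=> /andP[ab bc] [fr fi].
have key (h : R -> R) : mu.-integrable `[a, c] (EFin \o h) ->
    \int[mu]_(x in `[a, c]) h x = \int[mu]_(x in `[a, b]) h x + \int[mu]_(x in `[b, c]) h x.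
  move=> ih; apply/eqP; rewrite addrC -subr_eq; apply/eqP.
  rewrite (Rintegral_itvB ih) ?bnd_simp// Rintegral_itv_obnd_cbnd//.
  apply: integrableS ih => //; exact: subset_itvr.
by apply: complexP; rewrite ?(reCD, imCD)/=; exact: key.
Qed.

Lemma le_cabs_Cintegral_itv (a b M : R) f : a <= b -> Cintegrable `[a, b] f ->
  (forall x, a <= x <= b -> cabs (f x) <= M) ->
  cabs (Cintegral `[a, b] f) <= 2 * (M * (b - a)).
Proof.
move=> ab fi fM.
have := @le_cabs_Cintegral `[a, b] f (cst M).
rewrite Rintegral_cst//= lebesgue_measure_itv/= lte_fin.
have -> : fine (if a < b then (b%:E - a%:E)%E else 0%E) = b - a.
  case: ltP => //= ba; suff -> : a = b by rewrite subrr.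
  by apply/le_anti; rewrite ab.
apply => //.
apply: continuous_compact_integrable; first exact: segment_compact.
by apply: continuous_subspaceT => x; exact: cvg_cst.
Qed.

Lemma Rintegral_affine (a b p q : R) : a <= b ->
  \int[mu]_(x in `[a, b]) (p + q * x) = p * (b - a) + q * ((b ^+ 2 - a ^+ 2) / 2).
Proof.
rewrite le_eqVlt => /predU1P[->|ab].
  by rewrite set_itv1 Rintegral_set1 !subrr !mul0r !mulr0 addr0.
have dF (x : R) : is_derive x 1 (fun x : R => p * x + q * (x ^+ 2 / 2)) (p + q * x).
  by apply: is_derive_eq; rewrite /GRing.scale/=; field.
have cF : continuous (fun x : R => p * x + q * (x ^+ 2 / 2)).
  by move=> x; apply: differentiable_continuous; apply/derivable1_diffP; case: (dF x).
rewrite /Rintegral (@continuous_FTC2 _ _ (fun x => p * x + q * (x ^+ 2 / 2)))//=.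
- by rewrite /=; field.
- apply: continuous_subspaceT => x.
  by apply: cvgD; [exact: cvg_cst|apply: cvgM; [exact: cvg_cst|exact: cvg_id]].
- split => [x _||].
  + by case: (dF x).
  + by apply: cvg_at_right_filter; exact: cF.
  + by apply: cvg_at_left_filter; exact: cF.
- by move=> x _; rewrite derive1E; exact: derive_val.
Qed.

Lemma Cintegral_affine (a b : R) (p q : Cx R) : a <= b ->
  Cintegral `[a, b] (fun x => p + q * toC x) =
  p * toC (b - a) + q * toC ((b ^+ 2 - a ^+ 2) / 2).
Proof.
move=> ab; apply: complexP; rewrite !reimE /= ?mulr0 ?subr0 ?add0r -Rintegral_affine//;
  by apply: eq_Rintegral => x _; rewrite !reimE mulr0 ?subr0 ?add0r ?addr0.
Qed.

End ComplexIntegral.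

(** * Goursat's lemma for a family of tilted lines *)

Section IntervalArith.
Context {R : realType}.
Implicit Types a b h u p : R.

Lemma itv_sub a b a' b' u : a <= a' -> b' <= b -> a' <= u <= b' -> a <= u <= b.
Proof. by move=> ? ? /andP[? ?]; apply/andP; split; lra. Qed.

Lemma itv_dist a h u p : a <= u <= a + h -> a <= p <= a + h -> `|u - p| <= h.
Proof.
by move=> /andP[? ?] /andP[? ?]; rewrite ler_norml; apply/andP; split; lra.
Qed.

Lemma norm_itv01 u : 0 <= u <= 1 -> `|u| <= 1.
Proof. by move=> /andP[? ?]; rewrite ler_norml; apply/andP; split; lra. Qed.

End IntervalArith.

Section Goursat.
Context {R : realType}.
Variables c x : R.

(** [t = 0] is the real axis and [t = 1] the line of slope [c] through [x];
    [tilt_du] and [tilt_dt] are the partial derivatives. *)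
Definition tilt (u t : R) : Cx R := (u +i* (t * c * (u - x)))%C.
Definition tilt_du (t : R) : Cx R := (1 +i* (t * c))%C.
Definition tilt_dt (u : R) : Cx R := (0 +i* (c * (u - x)))%C.

Lemma cdiff_continuous (f : Cx R -> Cx R) z : cdiff f z -> {for z, continuous f}.
Proof.
move=> /cdiff_derivable/derivable1_diffP; exact: differentiable_continuous.
Qed.

Lemma cdiffB (f g : Cx R -> Cx R) z : cdiff f z -> cdiff g z ->
  cdiff (fun z => f z - g z) z.
Proof.
by move=> /cdiff_derivable df /cdiff_derivable dg; apply/derivable_cdiff/derivableB.
Qed.

Lemma cdiff_affine (p q z : Cx R) : cdiff (fun z => p + q * z) z.
Proof.
exists q => e e0; exists 1 => // y _.
have -> : p + q * y - (p + q * z) - q * (y - z) = 0 by ring.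
by rewrite cabs0 mulr_ge0 ?cabs_ge0 ?ltW.
Qed.

Lemma continuous_tilt_l t : continuous (tilt ^~ t).
Proof.
move=> u; apply: cvgC_reim => /=; first exact: cvg_id.
by apply: cvgM; [exact: cvg_cst|apply: cvgB; [exact: cvg_id|exact: cvg_cst]].
Qed.

Lemma continuous_tilt_r u : continuous (tilt u).
Proof.
move=> t; apply: cvgC_reim => /=; first exact: cvg_cst.
by do 2 (apply: cvgM; last exact: cvg_cst); exact: cvg_id.
Qed.

Lemma cdiff_tilt_l (f : Cx R -> Cx R) u t : cdiff f (tilt u t) ->
  {for u, continuous (fun u => f (tilt u t))}.
Proof.
move=> df; apply: (@continuous_comp _ _ _ (tilt ^~ t) f); first exact: continuous_tilt_l.
exact: cdiff_continuous.
Qed.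

Lemma cdiff_tilt_r (f : Cx R -> Cx R) u t : cdiff f (tilt u t) ->
  {for t, continuous (fun t => f (tilt u t))}.
Proof.
move=> df; apply: (@continuous_comp _ _ _ (tilt u) f); first exact: continuous_tilt_r.
exact: cdiff_continuous.
Qed.

(** The derivative factors stand outside the integrals because [tilt] is affine in each variable
    separately: [tilt_du t] is constant along a horizontal side, [tilt_dt u] along a vertical
    one. *)
Definition hedge f a b t := tilt_du t * Cintegral `[a, b] (fun u => f (tilt u t)).
Definition vedge f u s t := tilt_dt u * Cintegral `[s, t] (fun r => f (tilt u r)).
(** The integral of [f] along the image under [tilt] of the boundary of
    [[a, b] x [s, t]]; working in parameter space makes it additive under
    subdivision without any reparametrization. *)
Definition bdry f a b s t :=
  hedge f a b s + vedge f b s t - hedge f a b t - vedge f a s t.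

(** The side integrals of an affine function are explicit and cancel by computation. This lets the
    first-order Taylor polynomial be subtracted in Goursat's argument. *)
Lemma bdry_affine (p q : Cx R) a b s t : a <= b -> s <= t ->
  bdry (fun z => p + q * z) a b s t = 0.
Proof.
move=> ab st.
have hE r : hedge (fun z => p + q * z) a b r =
    tilt_du r * ((p + q * (0 +i* (- (r * c * x)))%C) * toC (b - a)
       + (q * tilt_du r) * toC ((b ^+ 2 - a ^+ 2) / 2)).
  rewrite /hedge -Cintegral_affine//; congr (_ * _); apply: eq_Cintegral => u _.
  by apply: complexP; rewrite !reimE /=; ring.
have vE u : vedge (fun z => p + q * z) u s t =
    tilt_dt u * ((p + q * toC u) * toC (t - s)
       + (q * tilt_dt u) * toC ((t ^+ 2 - s ^+ 2) / 2)).
  rewrite /vedge -Cintegral_affine//; congr (_ * _); apply: eq_Cintegral => r _.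
  by apply: complexP; rewrite !reimE /=; ring.
rewrite /bdry !hE !vE.
by apply: complexP; rewrite !reimE /=; field.
Qed.

Section Rectangle.
Variables (f : Cx R -> Cx R) (a b s t : R).
Hypothesis df : forall u r, a <= u <= b -> s <= r <= t -> cdiff f (tilt u r).

Lemma Cintegrable_hedge r : s <= r <= t -> Cintegrable `[a, b] (fun u => f (tilt u r)).
Proof. by move=> sr; apply: Cintegrable_itv => u ub; exact/cdiff_tilt_l/df. Qed.

Lemma Cintegrable_vedge u : a <= u <= b -> Cintegrable `[s, t] (fun r => f (tilt u r)).
Proof. by move=> sr; apply: Cintegrable_itv => r rt; exact/cdiff_tilt_r/df. Qed.

End Rectangle.

(** Each inner edge belongs to two adjacent quarters and is run through in opposite directions. *)
Lemma bdry_split f a m b s k t : a <= m <= b -> s <= k <= t ->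
  (forall u r, a <= u <= b -> s <= r <= t -> cdiff f (tilt u r)) ->
  bdry f a b s t = bdry f a m s k + bdry f m b s k + bdry f a m k t + bdry f m b k t.
Proof.
move=> /andP[am mb] /andP[sk kt] df.
have hE r : s <= r <= t -> hedge f a b r = hedge f a m r + hedge f m b r.
  move=> srt; rewrite /hedge -mulrDr -Cintegral_itv_split ?am//.
  exact: (Cintegrable_hedge _ _ _ _ _ df).
have vE u : a <= u <= b -> vedge f u s t = vedge f u s k + vedge f u k t.
  move=> aub; rewrite /vedge -mulrDr -Cintegral_itv_split ?sk//.
  exact: (Cintegrable_vedge _ _ _ _ _ df).
have ab := le_trans am mb; have st := le_trans sk kt.
have key (h1 h2 h3 h4 v1 v2 v3 v4 h5 h6 v5 v6 : Cx R) :
    h1 + h2 + (v1 + v2) - (h3 + h4) - (v3 + v4) =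
    h1 + v5 - h5 - v3 + (h2 + v1 - h6 - v5) + (h5 + v6 - h3 - v4) + (h6 + v2 - h4 - v6).
  by ring.
by rewrite /bdry !hE ?vE ?lexx ?ab ?st//; exact: key.
Qed.

(** Subtracting [p + q * z] does not change the boundary integral, so only the remainder, of size
    [M], counts. The constant 4 is the 2 of [le_cabs_Cintegral_itv] times two opposite sides. *)
Lemma le_bdry f (p q : Cx R) a b s t (M W V : R) : a <= b -> s <= t ->
  (forall u r, a <= u <= b -> s <= r <= t -> cdiff f (tilt u r)) ->
  (forall u r, a <= u <= b -> s <= r <= t ->
    cabs (f (tilt u r) - (p + q * tilt u r)) <= M) ->
  (forall r, s <= r <= t -> cabs (tilt_du r) <= W) ->
  (forall u, a <= u <= b -> cabs (tilt_dt u) <= V) ->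
  cabs (bdry f a b s t) <= 4 * M * (W * (b - a) + V * (t - s)).
Proof.
move=> ab st df fM hW hV.
pose L z := p + q * z; pose g z := f z - L z.
have dg u r : a <= u <= b -> s <= r <= t -> cdiff g (tilt u r).
  by move=> hu hr; apply: cdiffB; [exact: df|exact: cdiff_affine].
have dL u r : a <= u <= b -> s <= r <= t -> cdiff L (tilt u r).
  by move=> hu hr; exact: cdiff_affine.
have hE r : s <= r <= t -> hedge f a b r = hedge g a b r + hedge L a b r.
  move=> hr; rewrite /hedge -mulrDr -CintegralD//; last 2 first.
  + exact: (Cintegrable_hedge _ _ _ _ _ dg).
  + exact: (Cintegrable_hedge _ _ _ _ _ dL).
  by congr (_ * _); apply: eq_Cintegral => u _; rewrite /g subrK.
have vE u : a <= u <= b -> vedge f u s t = vedge g u s t + vedge L u s t.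
  move=> hr; rewrite /vedge -mulrDr -CintegralD//; last 2 first.
  + exact: (Cintegrable_vedge _ _ _ _ _ dg).
  + exact: (Cintegrable_vedge _ _ _ _ _ dL).
  by congr (_ * _); apply: eq_Cintegral => r _; rewrite /g subrK.
have key (h1 h2 h3 h4 v1 v2 v3 v4 : Cx R) :
    h1 + h2 + (v1 + v2) - (h3 + h4) - (v3 + v4) =
    h1 + v1 - h3 - v3 + (h2 + v2 - h4 - v4) by ring.
have -> : bdry f a b s t = bdry g a b s t.
  rewrite -[RHS]addr0 -(bdry_affine p q _ _ _ _ ab st) -/L /bdry.
  rewrite !hE ?vE ?lexx ?ab ?st//; exact: key.
have hB r : s <= r <= t -> cabs (hedge g a b r) <= 2 * (M * W * (b - a)).
  move=> hr; rewrite /hedge cabsM.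
  have := @le_cabs_Cintegral_itv _ a b M (fun u => g (tilt u r)) ab.
  move=> /(_ (Cintegrable_hedge _ _ _ _ _ dg _ hr) (fun u hu => fM u r hu hr)) h.
  apply: le_trans (ler_pM (cabs_ge0 _) (cabs_ge0 _) (hW _ hr) h) _.
  by rewrite le_eqVlt; apply/orP; left; apply/eqP; ring.
have vB u : a <= u <= b -> cabs (vedge g u s t) <= 2 * (M * V * (t - s)).
  move=> hu; rewrite /vedge cabsM.
  have := @le_cabs_Cintegral_itv _ s t M (fun r => g (tilt u r)) st.
  move=> /(_ (Cintegrable_vedge _ _ _ _ _ dg _ hu) (fun r hr => fM u r hu hr)) h.
  apply: le_trans (ler_pM (cabs_ge0 _) (cabs_ge0 _) (hV _ hu) h) _.
  by rewrite le_eqVlt; apply/orP; left; apply/eqP; ring.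
rewrite /bdry.
have tri (z1 z2 z3 z4 : Cx R) :
    cabs (z1 + z2 - z3 - z4) <= cabs z1 + cabs z2 + cabs z3 + cabs z4.
  apply: le_trans (le_cabsD _ _) _; rewrite cabsN lerD2r.
  apply: le_trans (le_cabsD _ _) _; rewrite cabsN lerD2r.
  exact: le_cabsD.
apply: le_trans (tri _ _ _ _) _.
have := hB s; have := hB t; have := vB a; have := vB b.
rewrite !lexx !ab !st => /(_ isT) h1 /(_ isT) h2 /(_ isT) h3 /(_ isT) h4.
apply: le_trans (lerD (lerD (lerD h4 h1) h3) h2) _.
by rewrite le_eqVlt; apply/orP; left; apply/eqP; ring.
Qed.

(** If the integral had modulus [e0 > 0], repeated quartering would give rectangles of side ratio
    [1 / 2 ^+ n] with integral at least [e0 / 4 ^+ n]. Differentiability at their common point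
    bounds the same integral by an arbitrarily small multiple of [1 / 4 ^+ n]. *)
Lemma goursat f a b : a <= b ->
  (forall u r, a <= u <= b -> 0 <= r <= 1 -> cdiff f (tilt u r)) ->
  bdry f a b 0 1 = 0.
Proof.
move=> ab df; apply/eqP; rewrite -[_ == _]negbK; apply/negP => nz.
set e0 := cabs (bdry f a b 0 1).
have e0p : 0 < e0.
  by rewrite lt_neqAle cabs_ge0 andbT eq_sym; apply: contra_neq nz; exact: Normc.eq0_normc.
pose P n a' s' := [/\ a <= a', a' + (b - a) / 2 ^+ n <= b, 0 <= s',
  s' + 1 / 2 ^+ n <= 1 &
  e0 / 4 ^+ n <= cabs (bdry f a' (a' + (b - a) / 2 ^+ n) s' (s' + 1 / 2 ^+ n))].
have W0 : 0 <= b - a by rewrite subr_ge0.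
have half (W : R) n : W / 2 ^+ n = W / 2 ^+ n.+1 + W / 2 ^+ n.+1.
  by rewrite exprS; field; rewrite expf_neq0.
have pos (W : R) n : 0 <= W -> 0 <= W / 2 ^+ n by move=> ?; rewrite divr_ge0// exprn_ge0.
have tri4 (z1 z2 z3 z4 : Cx R) (E : R) : cabs z1 < E -> cabs z2 < E ->
    cabs z3 < E -> cabs z4 < E -> cabs (z1 + z2 + z3 + z4) < 4 * E.
  have := le_cabsD (z1 + z2 + z3) z4; have := le_cabsD (z1 + z2) z3.
  by have := le_cabsD z1 z2; lra.
have step n a' s' : P n a' s' -> exists ij : bool * bool,
     P n.+1 (a' + ij.1%:R * ((b - a) / 2 ^+ n.+1)) (s' + ij.2%:R * (1 / 2 ^+ n.+1)).
  move=> [h1 h2 h3 h4 h5]; apply: contrapT => /forallNP nP.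
  move: h2 h4 h5; rewrite half (half 1).
  have := pos _ n.+1 W0; have := pos 1 n.+1 ler01.
  rewrite /P in nP; move: nP.
  set h := (b - a) / _; set k := 1 / _ => nP k0 h0 h2 h4.
  have -> : e0 / 4 ^+ n = 4 * (e0 / 4 ^+ n.+1) by rewrite exprS; field; rewrite expf_neq0.
  move: nP; set E := e0 / _ => nP.
  have bad (i j : bool) :
      cabs (bdry f (a' + i%:R * h) (a' + i%:R * h + h)
                   (s' + j%:R * k) (s' + j%:R * k + k)) < E.
    rewrite ltNge; apply/negP => hle; apply: (nP (i, j)); split => //=.
    - by apply: le_trans h1 _; rewrite lerDl mulr_ge0.
    - apply: le_trans h2; rewrite -addrA lerD2l lerD2r.
      by case: (i); rewrite ?mul1r ?mul0r.
    - by rewrite addr_ge0// mulr_ge0.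
    - apply: le_trans h4; rewrite -addrA lerD2l lerD2r.
      by case: (j); rewrite ?mul1r ?mul0r.
  move: (bad true true) (bad true false) (bad false true) (bad false false).
  rewrite !mul1r !mul0r !addr0 (addrA a') (addrA s') => b1 b2 b3 b4.
  rewrite (@bdry_split f a' (a' + h) (a' + h + h) s' (s' + k) (s' + k + k)); first last.
  + by move=> u r hu hr; apply: df; [apply: itv_sub hu|apply: itv_sub hr];
      rewrite // -addrA.
  + by rewrite !lerDl k0.
  + by rewrite !lerDl h0.
  by rewrite leNgt tri4.
have P0 : P 0%N a 0.
  rewrite /P expr0 !divr1 add0r (addrC a) subrK; split => //; exact: lexx.
have [p [q Hpq]] := dyadic_bisection (b - a) 1 P a 0 W0 ler01 step P0.
pose Y := `|a - x| + `|b - x|.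
have Y0 : 0 <= Y by rewrite addr_ge0.
have hY u : a <= u <= b -> `|u - x| <= Y.
  move=> /andP[au ub]; rewrite /Y ler_norml; apply/andP; split.
    have := ler_norm (- (a - x)); rewrite normrN; have := normr_ge0 (b - x); lra.
  have := ler_norm (b - x); have := normr_ge0 (a - x); lra.
have [abp q01] : a <= p <= b /\ 0 <= q <= 1.
  have [a' [s' [[h1 h2 h3 h4 _] /andP[h5 h6] /andP[h7 h8]]]] := Hpq 0%N.
  split; first by apply: (itv_sub _ _ _ _ _ h1 h2); rewrite h5.
  by apply: (itv_sub _ _ _ _ _ h3 h4); rewrite h7.
have [be Hbe] := df p q abp q01.
(* [C / 2 ^+ n] bounds the distance from [tilt p q] to the image of the rectangle of level [n]; see
   [dist] below. *)
pose C := (b - a) + `|c| * ((b - a) + Y).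
have c0 := normr_ge0 c.
have C0 : 0 <= C by rewrite addr_ge0// mulr_ge0// addr_ge0.
(* With Taylor error [eps * C / 2 ^+ n], [le_bdry] gives [eps * K / 4 ^+ n]. The choice
   [eps = e0 / (K + 1)] makes this strictly smaller than [e0 / 4 ^+ n], also when [K = 0]. *)
pose K := 4 * C * ((1 + `|c|) * (b - a) + `|c| * Y).
have K0 : 0 <= K.
  by rewrite /K !mulr_ge0// addr_ge0// mulr_ge0// addr_ge0.
have K1 : 0 < K + 1 by lra.
have [d d0 Hd] := Hbe (e0 / (K + 1)) (divr_gt0 e0p K1).
have [n Hn] : exists n, C / 2 ^+ n < d.
  have : (C * (2^-1 ^+ n)) @[n --> \oo] --> C * 0.
    by apply: cvgM; [exact: cvg_cst|apply: cvg_expr; rewrite ger0_norm; lra].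
  rewrite mulr0 => /cvgr_lt/(_ _ d0) [n _ /(_ n (leqnn n))] /= h.
  by exists n; rewrite -exprVn.
have [a' [s' [[h1 h2 h3 h4 h5] h6 h7]]] := Hpq n.
set h := (b - a) / 2 ^+ n in h2 h5 h6; set k := 1 / 2 ^+ n in h4 h5 h7.
have hk : h = (b - a) * k by rewrite /h /k; field; rewrite expf_neq0.
have k0 : 0 <= k := pos 1 n ler01.
have h0 : 0 <= h := pos _ n W0.
have dist u r : a' <= u <= a' + h -> s' <= r <= s' + k ->
    cabs (tilt u r - tilt p q) <= C * k.
  move=> hu hr; apply: le_trans (cabs_le_reim _) _; rewrite !reimE /=.
  have -> : r * c * (u - x) - q * c * (p - x) = c * (r * (u - p) + (r - q) * (p - x)) by ring.
  have up := itv_dist _ _ _ _ hu h6.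
  have rq := itv_dist _ _ _ _ hr h7.
  have r01 := norm_itv01 _ (itv_sub _ _ _ _ _ h3 h4 hr).
  have -> : C * k = h + `|c| * (h + Y * k) by rewrite hk /C; ring.
  rewrite normrM lerD// ler_wpM2l//.
  rewrite (le_trans (ler_normD _ _))// !normrM lerD//.
    by rewrite -[leRHS]mul1r ler_pM.
  by rewrite mulrC ler_pM// hY.
have Hn' : C * k < d by rewrite /k mulrA mulr1.
suff : cabs (bdry f a' (a' + h) s' (s' + k)) < e0 / 4 ^+ n by rewrite ltNge h5.
have hh : a' <= a' + h by rewrite lerDl.
have kk : s' <= s' + k by rewrite lerDl.
apply: (le_lt_trans (@le_bdry f (f (tilt p q) - be * tilt p q) be a' (a' + h)
  s' (s' + k) (e0 / (K + 1) * (C * k)) (1 + `|c|) (`|c| * Y) hh kk _ _ _ _)).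
- by move=> u r hu hr; apply: df; [apply: itv_sub hu|apply: itv_sub hr].
- move=> u r hu hr; have hdist := dist u r hu hr.
  have := Hd (tilt u r) (le_lt_trans hdist Hn').
  have -> : f (tilt u r) - (f (tilt p q) - be * tilt p q + be * tilt u r) =
    f (tilt u r) - f (tilt p q) - be * (tilt u r - tilt p q) by ring.
  move=> h8; apply: le_trans h8 _; apply: ler_wpM2l hdist.
  by rewrite divr_ge0 ?ltW.
- move=> r hr; apply: le_trans (cabs_le_reim _) _; rewrite /= normr1 lerD2l normrM.
  by rewrite -[leRHS]mul1r ler_wpM2r// norm_itv01// (itv_sub _ _ _ _ _ h3 h4).
- move=> u hu; apply: le_trans (cabs_le_reim _) _; rewrite /= normr0 add0r normrM.
  by rewrite ler_wpM2l// hY// (itv_sub _ _ _ _ _ h1 h2).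
have -> : 4 * (e0 / (K + 1) * (C * k)) *
   ((1 + `|c|) * (a' + h - a') + `|c| * Y * (s' + k - s')) = e0 * (K / (K + 1)) * k ^+ 2.
  by rewrite hk /K; field; rewrite gt_eqF.
have -> : e0 / 4 ^+ n = e0 * k ^+ 2.
  rewrite /k mul1r exprVn -exprM mulnC exprM; congr (_ / _ ^+ _).
  by rewrite expr2; lra.
rewrite ltr_pM2r; last by rewrite exprn_gt0// /k divr_gt0// exprn_gt0.
by rewrite gtr_pMr// ltr_pdivrMr// mul1r ltrDl.
Qed.

End Goursat.

(** * Shifting the contour *)

Section Improper.
Context {R : realType}.
Local Notation mu := (@lebesgue_measure R).

(** Comparing exponents forces the variance [1 / (2 * l)], and [sqrt(pi / l)] is the inverse of the
    resulting peak, hence the total mass. *)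
Lemma gaussian_normal_pdf (l m : R) : 0 < l ->
  (fun u => expR (- l * (u - m) ^+ 2)) =
  (fun u => Num.sqrt (pi / l) * normal_pdf m (Num.sqrt (1 / (2 * l))) u).
Proof.
move=> l0; apply/funext => u; rewrite normal_pdfE; last first.
  by rewrite gt_eqF// sqrtr_gt0 divr_gt0// mulr_gt0.
rewrite /normal_peak /normal_fun sqr_sqrtr; last by rewrite divr_ge0// mulr_ge0// ltW.
have -> : 1 / (2 * l) * pi *+ 2 = pi / l by rewrite mulr2n; field; rewrite gt_eqF.
rewrite mulVKf; last by rewrite gt_eqF// sqrtr_gt0 divr_gt0// pi_gt0.
by congr expR; rewrite mulr2n; field; rewrite gt_eqF.
Qed.

Lemma integrableMl_cst (k : R) (g : R -> R) : mu.-integrable setT (EFin \o g) ->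
  mu.-integrable setT (EFin \o (fun u => k * g u)).
Proof.
by move=> ig; have := integrableZl measurableT k ig; apply: eq_integrable.
Qed.

Lemma integrable_gaussian (l m : R) : 0 < l ->
  mu.-integrable setT (EFin \o (fun u => expR (- l * (u - m) ^+ 2))).
Proof.
move=> l0; rewrite gaussian_normal_pdf//; apply: integrableMl_cst.
exact: integrable_normal_pdf.
Qed.

Lemma Rintegral_gaussian (l m : R) : 0 < l ->
  \int[mu]_u expR (- l * (u - m) ^+ 2) = Num.sqrt (pi / l).
Proof.
move=> l0; rewrite gaussian_normal_pdf// RintegralZl//; last exact: integrable_normal_pdf.
by rewrite /Rintegral integral_normal_pdf mulr1.
Qed.

Lemma dominated_convergence_Rintegral (f_ : nat -> R -> R) (f g : R -> R) :
  (forall n, measurable_fun setT (f_ n)) -> measurable_fun setT f ->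
  (forall x, f_ n x @[n --> \oo] --> f x) ->
  mu.-integrable setT (EFin \o g) -> (forall n x, `|f_ n x| <= g x) ->
  \int[mu]_x f_ n x @[n --> \oo] --> \int[mu]_x f x.
Proof.
move=> mf_ mf ff ig fg.
have [||//|||fi _ H] := @dominated_convergence _ _ R mu setT measurableT
    (fun n => EFin \o f_ n) (EFin \o f) (EFin \o g).
- by move=> n; apply/measurable_EFinP; exact: mf_.
- by apply/measurable_EFinP; exact: mf.
- by apply/aeW => x _; apply: cvg_comp (ff x) _; exact: cvg_id.
- exact: ig.
- by apply/aeW => x n _ /=; rewrite lee_fin.
apply: (@fine_cvg _ _ _ _ (fun n => \int[mu]_x (f_ n x)%:E)%E).
rewrite /Rintegral fineK//; exact: integrable_fin_num.
Qed.

Lemma cvg_Cintegral_dominated (f_ : nat -> R -> Cx R) (f : R -> Cx R) (g : R -> R) :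
  (forall n, continuous (f_ n)) -> continuous f ->
  (forall x, f_ n x @[n --> \oo] --> f x) ->
  mu.-integrable setT (EFin \o g) -> (forall n x, cabs (f_ n x) <= g x) ->
  Cintegral setT (f_ n) @[n --> \oo] --> Cintegral setT f.
Proof.
move=> cf_ cf ff ig fg; apply: cvgC_reim.
- apply: (dominated_convergence_Rintegral _ _ g) => //.
  + move=> n; apply: continuous_measurable_fun => x.
    by apply: (@continuous_comp _ _ _ (f_ n) (@reC R)); [exact: cf_|exact: continuous_reC].
  + apply: continuous_measurable_fun => x.
    by apply: (@continuous_comp _ _ _ f (@reC R)); [exact: cf|exact: continuous_reC].
  + by move=> x; apply: (cvg_comp _ _ (ff x)); exact: continuous_reC.
  + by move=> n x; apply: le_trans (fg n x); exact: le_reC_cabs.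
- apply: (dominated_convergence_Rintegral _ _ g) => //.
  + move=> n; apply: continuous_measurable_fun => x.
    by apply: (@continuous_comp _ _ _ (f_ n) (@imC R)); [exact: cf_|exact: continuous_imC].
  + apply: continuous_measurable_fun => x.
    by apply: (@continuous_comp _ _ _ f (@imC R)); [exact: cf|exact: continuous_imC].
  + by move=> x; apply: (cvg_comp _ _ (ff x)); exact: continuous_imC.
  + by move=> n x; apply: le_trans (fg n x); exact: le_imC_cabs.
Qed.

Lemma Cintegrable_continuous (f : R -> Cx R) (g : R -> R) : continuous f ->
  mu.-integrable setT (EFin \o g) -> (forall x, cabs (f x) <= g x) ->
  Cintegrable setT f.
Proof.
move=> cf ig fg; apply: Cintegrable_dominated ig _ => //.
- apply: continuous_measurable_fun => x.
  by apply: (@continuous_comp _ _ _ f (@reC R)); [exact: cf|exact: continuous_reC].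
- apply: continuous_measurable_fun => x.
  by apply: (@continuous_comp _ _ _ f (@imC R)); [exact: cf|exact: continuous_imC].
Qed.

Lemma cvg_Rintegral_itv (h : R -> R) : mu.-integrable setT (EFin \o h) ->
  \int[mu]_(x in `[- n.+1%:R, n.+1%:R]) h x @[n --> \oo] --> \int[mu]_x h x.
Proof.
move=> ih; have mh : measurable_fun setT h.
  by apply/measurable_EFinP; case/integrableP: ih.
under eq_fun do rewrite Rintegral_mkcond.
apply: (dominated_convergence_Rintegral _ _ (fun x => `|h x|)) => //.
- move=> n; apply/(measurable_restrictT h) => //.
  exact: measurable_funTS.
- move=> x; apply: cvg_near_cst; exists (Num.truncn `|x|) => // n /= hn.
  rewrite patchE mem_set//= in_itv/= -ler_norml ltW//.
  by apply: lt_le_trans (truncnS_gt _) _; rewrite ler_nat ltnS.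
- exact: integrable_norm ih.
- move=> n x; rewrite patchE; case: ifP => //; by rewrite normr0.
Qed.

Lemma cvg_Cintegral_itv (f : R -> Cx R) : Cintegrable setT f ->
  Cintegral `[- n.+1%:R, n.+1%:R] f @[n --> \oo] --> Cintegral setT f.
Proof. by move=> [fr fi]; apply: cvgC_reim; exact: cvg_Rintegral_itv. Qed.

(** Goursat's lemma on [[-N, N] x [0, 1]] reduces the difference of the two truncated line integrals
    to the two vertical sides. Their length grows like [N] while the integrand decays like a
    Gaussian. *)
Lemma contour_shift (c x : R) (f : Cx R -> Cx R) (M l : R) : 0 < l -> 0 <= M ->
  (forall u r, 0 <= r <= 1 -> cdiff f (tilt c x u r)) ->
  (forall u r, 0 <= r <= 1 -> cabs (f (tilt c x u r)) <= M * expR (- l * u ^+ 2)) ->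
  Cintegral setT (fun u => f (toC u)) = tilt_du c 1 * Cintegral setT (fun u => f (tilt c x u 1)).
Proof.
move=> l0 M0 df fM.
have ig : mu.-integrable setT (EFin \o (fun u => M * expR (- l * u ^+ 2))).
  apply: integrableMl_cst; have := integrable_gaussian l 0 l0.
  by apply: eq_integrable => // u _ /=; rewrite subr0.
have r00 : 0 <= (0 : R) <= 1 by rewrite lexx ler01.
have r11 : 0 <= (1 : R) <= 1 by rewrite lexx ler01.
have t0 : (fun u => f (toC u)) = (fun u => f (tilt c x u 0)).
  by apply/funext => u; congr f; apply: complexP => //=; rewrite !mul0r.
have ci r : 0 <= r <= 1 -> Cintegrable setT (fun u => f (tilt c x u r)).
  move=> hr; apply: Cintegrable_continuous ig _; last by move=> u; exact: fM.
  by move=> u; apply/cdiff_tilt_l/df.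
have w0 : tilt_du c 0 = 1 by apply: complexP => //=; rewrite mul0r.
pose Z n := tilt_du c 0 * Cintegral `[- n.+1%:R, n.+1%:R] (fun u => f (tilt c x u 0)) -
  tilt_du c 1 * Cintegral `[- n.+1%:R, n.+1%:R] (fun u => f (tilt c x u 1)).
pose L := Cintegral setT (fun u => f (toC u)) - tilt_du c 1 * Cintegral setT (fun u => f (tilt c x u 1)).
have ZL : Z n @[n --> \oo] --> L.
  have hz r : 0 <= r <= 1 ->
      tilt_du c r * Cintegral `[- n.+1%:R, n.+1%:R] (fun u => f (tilt c x u r))
        @[n --> \oo] --> tilt_du c r * Cintegral setT (fun u => f (tilt c x u r)).
    by move=> hr; exact: (cvgM (cvg_cst _) (cvg_Cintegral_itv _ (ci _ hr))).
  by rewrite /L t0 -[X in X - _]mul1r -w0; exact: (cvgB (hz 0 r00) (hz 1 r11)).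
have Z0 : Z n @[n --> \oo] --> (0 : Cx R).
  (* [K / 2 / N] bounds one vertical side: speed at most [|c| (1 + |x|) N], integral at most
     [2 M / (l N^2)]. *)
  pose K := 4 * `|c| * (1 + `|x|) * M / l.
  apply/(@cvgC _ _ \oo) => e e0.
  have K0 : 0 <= K by rewrite /K !mulr_ge0// ?invr_ge0 ?addr_ge0// ltW.
  have K1 : 0 < K + 1 by rewrite ltr_wpDl.
  have := @cvg_harmonic R => /cvgr_lt/(_ (e / (K + 1)) (divr_gt0 e0 K1)).
  apply: filterS => n; rewrite [harmonic n]/= => hn.
  set N : R := n.+1%:R; have N1 : 1 <= N by rewrite ler1n.
  have NN : - N <= N by lra.
  have := @goursat _ c x f (- N) N NN (fun u r _ => df u r).
  have mv (h v h' v' : Cx R) : h + v - h' - v' = 0 -> h - h' = v' - v.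
    by move=> hv; apply/eqP; rewrite -subr_eq0 -hv; apply/eqP; ring.
  rewrite /bdry /hedge /vedge sub0r cabsN => /mv E0; rewrite /Z -/N {}E0.
  have vb u : `|u| = N -> cabs (tilt_dt c x u * Cintegral `[0, 1] (fun r => f (tilt c x u r)))
       <= K / 2 / N.
    move=> uN; rewrite cabsM.
    have := @le_cabs_Cintegral_itv _ 0 1 (M * expR (- l * u ^+ 2)) (fun r => f (tilt c x u r)) ler01.
    move=> /(_ _ (fun r hr => fM u r hr)) h.
    have {}h := h (@Cintegrable_vedge _ c x f u u 0 1 (fun v r _ => df v r) u _).
    have {}h := h (ltac:(by rewrite lexx)).
    have h2 : cabs (tilt_dt c x u) <= `|c| * ((1 + `|x|) * N).
      apply: le_trans (cabs_le_reim _) _; rewrite /= normr0 add0r normrM ler_wpM2l//.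
      apply: le_trans (ler_normB _ _) _; rewrite uN mulrDl mul1r lerD2l.
      by rewrite ler_peMr.
    apply: le_trans (ler_pM (cabs_ge0 _) (cabs_ge0 _) h2 h) _.
    (* A polynomial bound suffices: [l N^2 <= 1 + l N^2 <= exp(l N^2)]. *)
    have h3 : expR (- l * u ^+ 2) <= (l * N ^+ 2)^-1.
      have lN : 0 < l * N ^+ 2 by rewrite mulr_gt0// exprn_gt0// (lt_le_trans ltr01).
      rewrite mulNr expRN lef_pV2 ?posrE ?expR_gt0//.
      rewrite -(@real_normK _ u) ?num_real// uN.
      by apply: le_trans (expR_ge1Dx _); rewrite lerDr.
    have -> : K / 2 / N = `|c| * ((1 + `|x|) * N) * (2 * (M * (l * N ^+ 2)^-1 * (1 - 0))).
      by rewrite /K; field; rewrite !gt_eqF// (lt_le_trans ltr01).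
    have N0 : 0 <= N by rewrite (le_trans ler01).
    apply: ler_wpM2l; first by rewrite mulr_ge0// mulr_ge0// addr_ge0.
    by rewrite subr0 !mulr1 ler_wpM2l// ler_wpM2l.
  apply: le_lt_trans (le_cabsD _ _) _; rewrite cabsN.
  apply: le_lt_trans (lerD (vb _ _) (vb _ _)) _.
  + by rewrite normrN ger0_norm; lra.
  + by rewrite ger0_norm; lra.
  have -> : K / 2 / N + K / 2 / N = K * N^-1 by field; rewrite gt_eqF// (lt_le_trans ltr01).
  have N0 : 0 < N by lra.
  have hn' : N^-1 * (K + 1) < e by rewrite -ltr_pdivlMr.
  apply: le_lt_trans hn'; rewrite mulrDr mulrC lerDl mulr1 invr_ge0; lra.
have L0 : L = 0 by exact: (cvg_unique _ ZL Z0).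
by apply/eqP; rewrite -subr_eq0; apply/eqP.
Qed.

End Improper.

(** * The complex exponential and the double sector *)

Section ComplexExp.
Context {R : realType}.
Implicit Types z w : Cx R.

Lemma cexpE z : cexp z = (expR (reC z) * cos (imC z) +i* (expR (reC z) * sin (imC z)))%C.
Proof. by apply: complexP; rewrite /cexp !reimE /=; ring. Qed.

Lemma cabs_cexp z : cabs (cexp z) = expR (reC z).
Proof.
rewrite cexpE cabsE /= !exprMn -mulrDr cos2Dsin2 mulr1 sqrtr_sqr.
by rewrite ger0_norm// expR_ge0.
Qed.

Lemma cexpD z w : cexp (z + w) = cexp z * cexp w.
Proof.
rewrite !cexpE reCD imCD expRD cosD sinD.
by apply: complexP; rewrite !reimE /=; ring.
Qed.

Lemma cexp_toC (r : R) : cexp (toC r) = toC (expR r).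
Proof. by rewrite cexpE /= cos0 sin0 mulr1 mulr0. Qed.

Lemma is_derive_taylor (f : R -> R) (p d : R) : is_derive p 1 f d ->
  forall e, 0 < e -> exists2 dl, 0 < dl & forall h, `|h| < dl ->
    `|f (p + h) - f p - d * h| <= e * `|h|.
Proof.
move=> [/cvg_ex[b Hb] <-] e e0; have -> : 'D_1 f p = b by exact: cvg_lim Hb.
move/cvgrPdist_le : Hb => /(_ e e0)[dl/= dl0 hd]; exists dl => // h hdl.
have [->|h0] := eqVneq h 0; first by rewrite addr0 subrr mulr0 subr0 normr0 mulr0.
have := hd h; rewrite /= sub0r normrN hdl => /(_ isT h0).
rewrite [_%:A]mulr1 [_ *: _]/( _ * _) (addrC h) => hle.
have -> : f (p + h) - f p - b * h = - ((b - h^-1 * (f (p + h) - f p)) * h).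
  by field.
by rewrite normrN normrM ler_wpM2r.
Qed.

(** The real expansions of [expR], [cos] and [sin] at 0 with precision [n] leave four error terms,
    at most [n], [2n], [3n] and [2n] times [cabs z]; this is the 8 in [8 * n <= e]. The origin
    suffices, since the addition formula carries the estimate to every point. *)
Lemma cexp_taylor0 (e : R) : 0 < e -> exists2 d : R, 0 < d & forall z,
  cabs z < d -> cabs (cexp z - 1 - z) <= e * cabs z.
Proof.
move=> e0; have [n [n0 n1 ne]] : exists n : R, [/\ 0 < n, n <= 1 & 8 * n <= e].
  exists (Num.min 1 (e / 8)); split; first by rewrite lt_min ltr01 divr_gt0.
    by rewrite ge_min lexx.
  by rewrite mulrC -ler_pdivlMr// ge_min lexx orbT.
have [d1 d10 h1] := is_derive_taylor _ _ _ (is_derive_expR 0) _ n0.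
have [d2 d20 h2] := is_derive_taylor _ _ _ (is_derive_cos 0) _ n0.
have [d3 d30 h3] := is_derive_taylor _ _ _ (is_derive_sin 0) _ n0.
exists (Num.min (Num.min d1 d2) (Num.min d3 n)).
  by rewrite !lt_min d10 d20 d30 n0.
move=> z; rewrite !lt_min => /andP[/andP[zd1 zd2] /andP[zd3 zn]].
have ru := le_reC_cabs z; have iv := le_imC_cabs z.
have {}h1 := h1 _ (le_lt_trans ru zd1).
have {}h2 := h2 _ (le_lt_trans iv zd2).
have {}h3 := h3 _ (le_lt_trans iv zd3).
move: h1 h2 h3; rewrite !add0r expR0 cos0 sin0 oppr0 mul0r !mul1r !subr0 addr0.
rewrite cexpE; set u := reC z in ru *; set v := imC z in iv * => h1 h2 h3.
have -> : ((expR u * cos v +i* (expR u * sin v))%C : Cx R) - 1 - z =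
    (((expR u - 1 - u) * cos v + (1 + u) * (cos v - 1)) +i*
     (expR u * (sin v - v) + (expR u - 1) * v))%C :> Cx R.
  by apply: complexP; rewrite !reimE /= -?/u -?/v; ring.
apply: le_trans (cabs_le_reim _) _; rewrite /=.
have cz := cabs_ge0 z.
have un : `|u| <= n by rewrite (le_trans ru)// ltW.
have eu : `|expR u - 1| <= 2 * `|u|.
  have -> : expR u - 1 = (expR u - 1 - u) + u by ring.
  apply: le_trans (ler_normD _ _) _; have : n * `|u| <= 1 * `|u| by rewrite ler_wpM2r.
  lra.
have e3 : `|expR u| <= 3.
  have -> : expR u = (expR u - 1) + 1 by ring.
  apply: le_trans (ler_normD _ _) _; rewrite normr1; lra.
have t1 : `|(expR u - 1 - u) * cos v| <= n * cabs z.
  rewrite normrM -[leRHS]mulr1 ler_pM//; last by rewrite cos_max.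
  by apply: le_trans h1 _; rewrite ler_wpM2l// ltW.
have t2 : `|(1 + u) * (cos v - 1)| <= 2 * (n * cabs z).
  rewrite normrM ler_pM//.
    by apply: le_trans (ler_normD _ _) _; rewrite normr1; lra.
  by apply: le_trans h2 _; rewrite ler_wpM2l// ltW.
have t3 : `|expR u * (sin v - v)| <= 3 * (n * cabs z).
  rewrite normrM ler_pM//.
  by apply: le_trans h3 _; rewrite ler_wpM2l// ltW.
have t4 : `|(expR u - 1) * v| <= 2 * n * cabs z.
  by rewrite normrM ler_pM//; lra.
have tt1 := ler_normD ((expR u - 1 - u) * cos v) ((1 + u) * (cos v - 1)).
have tt2 := ler_normD (expR u * (sin v - v)) ((expR u - 1) * v).
have : 8 * n * cabs z <= e * cabs z by rewrite ler_wpM2r.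
lra.
Qed.

Lemma cdiff_cexp z : cdiff cexp z.
Proof.
exists (cexp z) => e e0.
have ep : 0 < e / expR (reC z) by rewrite divr_gt0// expR_gt0.
have [d d0 hd] := cexp_taylor0 _ ep; exists d => // w wd.
have -> : cexp w - cexp z - cexp z * (w - z) =
    cexp z * (cexp (w - z) - 1 - (w - z)).
  have -> : cexp w = cexp z * cexp (w - z) by rewrite -cexpD addrC subrK.
  ring.
rewrite cabsM cabs_cexp.
have := ler_wpM2l (expR_ge0 (reC z)) (hd _ wd).
by rewrite [leRHS]mulrA (mulrC (expR _) (e / _)) divfK// gt_eqF// expR_gt0.
Qed.

Lemma cdiff_sqr (k z : Cx R) : cdiff (fun z => k * z ^+ 2) z.
Proof.
exists (k * (z + z)) => e e0.
have k1 : 0 < cabs k + 1 by rewrite ltr_wpDl// cabs_ge0.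
exists (e / (cabs k + 1)); first by rewrite divr_gt0.
move=> w; rewrite ltr_pdivlMr// => wz.
have -> : k * w ^+ 2 - k * z ^+ 2 - k * (z + z) * (w - z) = (w - z) * k * (w - z).
  by ring.
rewrite !cabsM ler_wpM2r ?cabs_ge0//; have := cabs_ge0 (w - z); lra.
Qed.

Lemma cdiff_gauss (k : Cx R) z : cdiff (fun z => cexp (k * z ^+ 2)) z.
Proof.
apply: derivable_cdiff; apply/derivable1_diffP.
apply: (@differentiable_comp _ _ _ _ (fun z : Cx R => k * z ^+ 2) cexp).
  by apply/derivable1_diffP; exact/cdiff_derivable/cdiff_sqr.
by apply/derivable1_diffP; exact/cdiff_derivable/cdiff_cexp.
Qed.

End ComplexExp.

(** * The double sector in Cartesian terms, and the slopes that stay in the domain *)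

Section Sector.
Context {R : realType}.
Variables (alpha : R) (Om : set (Cx R)).
Hypotheses (alpha0 : 0 < alpha) (alpha_lt : alpha < pi / 2).

Lemma polar (r t : R) : toC r * cexp ('i%C * toC t) = (r * cos t +i* (r * sin t))%C.
Proof.
have -> : 'i%C * toC t = (0 +i* t)%C :> Cx R.
  by apply: complexP; rewrite !reimE /=; ring.
by rewrite cexpE /= expR0 !mul1r; apply: complexP; rewrite !reimE /=; ring.
Qed.

Lemma sin_atan (y : R) : sin (atan y) = y * cos (atan y).
Proof.
have := atanK y; rewrite /tan => h; rewrite -[X in X * _]h divfK// cos_atan invr_neq0//.
by rewrite gt_eqF// sqrtr_gt0 ltr_wpDr// sqr_ge0.
Qed.

Lemma cos_atanK (y : R) : Num.sqrt (1 + y ^+ 2) * cos (atan y) = 1.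
Proof.
by rewrite cos_atan divff// gt_eqF// sqrtr_gt0 ltr_wpDr// sqr_ge0.
Qed.

Lemma tan_gt0 : 0 < tan alpha.
Proof.
rewrite /tan divr_gt0//.
  by apply: sin_gt0_pi; rewrite alpha0 (lt_trans alpha_lt)// ltr_pdivrMr// ltr_pMr ?pi_gt0// ltr1n.
by apply: cos_gt0_pihalf; rewrite alpha_lt andbT (lt_trans _ alpha0)// oppr_lt0 divr_gt0// pi_gt0.
Qed.

Lemma atan_sector (y : R) : 0 <= y <= tan alpha -> 0 <= atan y <= alpha.
Proof.
move=> /andP[y0 ya]; rewrite -{1}(@atan0 R) le_atan//=.
rewrite -[leRHS](@tanK R) ?le_atan// in_itv/= alpha_lt andbT.
by rewrite (lt_trans _ alpha0)// oppr_lt0 divr_gt0// pi_gt0.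
Qed.

Lemma double_sector_pos (u v : R) : 0 < u -> 0 <= v <= tan alpha * u ->
  double_sector alpha (u +i* v)%C.
Proof.
move=> u0 /andP[v0 vu]; right.
exists (u * Num.sqrt (1 + (v / u) ^+ 2)), (atan (v / u)); split; last split.
- by rewrite mulr_gt0// sqrtr_gt0 ltr_wpDr// sqr_ge0.
- by left; apply: atan_sector; rewrite ler_pdivrMr// vu andbT divr_ge0// ltW.
rewrite polar sin_atan.
have := cos_atanK (v / u); set q := Num.sqrt _; set w := cos _ => qw.
have -> : u * q * w = u * (q * w) by ring.
have -> : u * q * (v / u * w) = v * (q * w) by field; rewrite gt_eqF.
by rewrite qw !mulr1.
Qed.

Lemma double_sector_neg (u v : R) : u < 0 -> tan alpha * u <= v <= 0 ->
  double_sector alpha (u +i* v)%C.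
Proof.
move=> u0 /andP[vu v0]; right.
have nu0 : 0 < - u by lra.
exists (- u * Num.sqrt (1 + (v / u) ^+ 2)), (pi + atan (v / u)); split; last split.
- by rewrite mulr_gt0// sqrtr_gt0 ltr_wpDr// sqr_ge0.
- right; rewrite lerDl lerD2l; apply: atan_sector.
  have -> : v / u = - v / - u by field; rewrite lt_eqF.
  rewrite ler_pdivrMr// mulrN lerN2 vu andbT divr_ge0 ?oppr_ge0//; exact: ltW.
rewrite polar (addrC pi) cosDpi sinDpi sin_atan.
have := cos_atanK (v / u); set q := Num.sqrt _; set w := cos _ => qw.
have -> : - u * q * - w = u * (q * w) by ring.
have -> : - u * q * - (v / u * w) = v * (q * w) by field; rewrite lt_eqF.
by rewrite qw !mulr1.
Qed.

Lemma double_sector_real (u : R) : double_sector alpha (toC u).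
Proof.
have t0 := tan_gt0; have [u0|u0|->] := ltgtP u 0; last by left.
- by apply: double_sector_neg => //; rewrite lexx andbT pmulr_rle0// ltW.
- by apply: double_sector_pos => //; rewrite lexx mulr_ge0// ltW.
Qed.

Hypotheses (oOm : open Om) (SOm : double_sector alpha `<=` Om).

(** Each real point has a neighbourhood inside [Om]; compactness of [[-M, M]] makes its height
    uniform. *)
Lemma real_strip (M : R) : exists2 d : R, 0 < d & forall u v : R,
  `|u| <= M -> `|v| < d -> Om (u +i* v)%C.
Proof.
have /compact_near_coveringP := @segment_compact R (- M) M.
move=> /(_ R (nbhs (0 : R)) (fun v u => Om (u +i* v)%C) _)[].
  move=> u uM; have Omu := SOm _ (double_sector_real u).
  have : nbhs (toC u) Om by exact: open_nbhs_nbhs.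
  move=> /nbhs_ballP[e]; rewrite /= ltcE /= => /andP[/eqP ei e0] he.
  have e2 : 0 < complex.Re e / 2 by rewrite divr_gt0.
  exists (ball u (complex.Re e / 2), ball (0 : R) (complex.Re e / 2)) => /=.
    by split; exact: nbhsx_ballx.
  move=> [u' v] /= [hu hv]; apply: he.
  have h : cabs (toC u - (u' +i* v)%C) < complex.Re e.
    apply: le_lt_trans (cabs_le_reim _) _; rewrite /= sub0r normrN.
    move: hu hv; rewrite -!ball_normE/= sub0r normrN; lra.
  rewrite -ball_normE/= normC_cabs ltcE; apply/andP; split; last exact: h.
  exact/eqP.
move=> d /= d0 hd; exists d => // u v uM vd; apply: (hd v).
  by rewrite /= sub0r normrN.
by rewrite /= in_itv/= -ler_norml.
Qed.

Lemma tilt_mem (X : R) : 0 <= X -> exists c : R, 0 < c <= 1 / 2 /\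
  forall x u r, `|x| <= X -> 0 <= r <= 1 -> Om (tilt c x u r).
Proof.
move=> X0; have [d d0 hd] := real_strip (X + 1).
have t0 := tan_gt0.
have X2 : 0 < 2 * X + 2 by lra.
(* For [|u| <= X + 1], [|u - x| <= 2 X + 1], and the third bound keeps the line in the strip of
   height [d]. For larger [|u|], [u - x] has the sign of [u] and [|u - x| <= 2 |u|], so
   [tan alpha / 2] keeps it in the sector. The bound [1 / 2] serves the modulus estimates on the
   rotated line. *)
pose c := Num.min (Num.min (1 / 2) (tan alpha / 2)) (d / (2 * X + 2)).
have c0 : 0 < c by rewrite /c !lt_min; apply/andP; split; [apply/andP; split|]; apply: divr_gt0.
have c1 : c <= 1 / 2 by rewrite /c !ge_min lexx.
have c2 : c <= tan alpha / 2 by rewrite /c !ge_min lexx orbT.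
have c3 : c <= d / (2 * X + 2) by rewrite /c !ge_min lexx orbT.
exists c; split; first by rewrite c0 c1.
move=> x u r xX /andP[r0 r1].
have c20 := ltW c0.
have rc0 : 0 <= r * c by rewrite mulr_ge0.
have rc1 : r * c <= tan alpha / 2.
  by apply: le_trans c2; rewrite -[leRHS]mul1r ler_wpM2r.
have rc2 : r * c <= d / (2 * X + 2).
  by apply: le_trans c3; rewrite -[leRHS]mul1r ler_wpM2r.
move: xX; rewrite ler_norml => /andP[xX1 xX2].
have [uM|uM] := leP `|u| (X + 1).
  apply: hd => //; rewrite normrM ger0_norm//.
  move: uM; rewrite ler_norml => /andP[u1 u2].
  have : `|u - x| <= 2 * X + 1 by rewrite ler_norml; apply/andP; split; lra.
  move=> ux; apply: (@le_lt_trans _ _ (d / (2 * X + 2) * (2 * X + 1))).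
    by rewrite ler_pM.
  rewrite -mulrA gtr_pMr// mulrC ltr_pdivrMr//; lra.
apply: SOm; move: uM; rewrite ltr_normr => /orP[uM|uM].
- apply: double_sector_pos; first by lra.
  have ux : 0 <= u - x by lra.
  have ux2 : u - x <= 2 * u by lra.
  rewrite mulr_ge0//=; apply: le_trans (ler_pM rc0 ux rc1 ux2) _.
  by rewrite le_eqVlt; apply/orP; left; apply/eqP; field.
- apply: double_sector_neg; first by lra.
  have ux : 0 <= x - u by lra.
  have ux2 : x - u <= - 2 * u by lra.
  rewrite -(opprB x u) mulrN oppr_le0 mulr_ge0// andbT lerNr.
  apply: le_trans (ler_pM rc0 ux rc1 ux2) _.
  by rewrite le_eqVlt; apply/orP; left; apply/eqP; field.
Qed.

End Sector.

(** * The kernel on the rotated line *)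

Section Exponents.
Context {R : realType}.

Lemma gauss_linear_le (e D y : R) : 0 < e ->
  - (e / 2) * y ^+ 2 + 2 * D * `|y| <= - (e / 4) * y ^+ 2 + 4 * D ^+ 2 / e.
Proof.
move=> e0; rewrite -subr_ge0.
have -> : - (e / 4) * y ^+ 2 + 4 * D ^+ 2 / e - (- (e / 2) * y ^+ 2 + 2 * D * `|y|) =
    (e * `|y| - 4 * D) ^+ 2 / (4 * e).
  rewrite -(@real_normK _ y) ?num_real//; field; rewrite gt_eqF//.
by rewrite divr_ge0 ?sqr_ge0// mulr_ge0// ltW.
Qed.

End Exponents.

Section RotatedKernel.
Context {R : realType}.
Local Notation mu := (@lebesgue_measure R).
Variables (c x a al be : R) (Om : set (Cx R)) (g : Cx R -> Cx R).
Hypotheses (c0 : 0 < c) (c2 : c <= 1 / 2) (a0 : 0 < a) (al0 : 0 <= al) (be0 : 0 <= be).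
Hypothesis oOm : forall u r, 0 <= r <= 1 -> Om (tilt c x u r).
Hypothesis dg : holo_on Om g.
Hypothesis gle : forall z, Om z -> cabs (g z) <=
  cabs (cexp ('i%C * toC a * (z - toC x) ^+ 2)) * (al * expR (be * cabs z)).

Lemma cabs_chirp_tilt (u r : R) :
  cabs (cexp ('i%C * toC a * (tilt c x u r - toC x) ^+ 2)) =
  expR (- (2 * a * (r * c)) * (u - x) ^+ 2).
Proof. by rewrite cabs_cexp; congr expR; rewrite expr2 !reimE /=; ring. Qed.

Lemma cabs_tilt (u r : R) : 0 <= r <= 1 -> cabs (tilt c x u r) <= 2 * `|u| + `|x|.
Proof.
move=> /andP[r0 r1]; apply: le_trans (cabs_le_reim _) _; rewrite /= normrM.
have rc0 : 0 <= r * c by rewrite mulr_ge0// ltW.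
have rc : r * c <= 1 / 2 by apply: le_trans c2; rewrite -[leRHS]mul1r ler_wpM2r// ltW.
have h := ler_normB u x.
have : `|r * c| * `|u - x| <= 1 / 2 * (`|u| + `|x|) by rewrite ler_pM// ger0_norm.
have := normr_ge0 u; have := normr_ge0 x; lra.
Qed.

(** A slope of at most [1 / 2] keeps [Re (z^2)] above [(u^2 - x^2) / 2], so the regularizer still
    decays on all intermediate lines. *)
Lemma cabs_gauss_tilt (e u r : R) : 0 <= e -> 0 <= r <= 1 ->
  cabs (cexp (toC (- e) * tilt c x u r ^+ 2)) <= expR (- (e / 2) * u ^+ 2 + e / 2 * x ^+ 2).
Proof.
move=> e0 /andP[r0 r1]; rewrite cabs_cexp ler_expR expr2 !reimE /=.
have rc0 : 0 <= r * c by rewrite mulr_ge0// ltW.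
have rc : r * c <= 1 / 2 by apply: le_trans c2; rewrite -[leRHS]mul1r ler_wpM2r// ltW.
have h1 : (r * c) ^+ 2 <= (1 / 2) ^+ 2 by rewrite ler_pXn2r ?nnegrE//; lra.
have h2 : (r * c) ^+ 2 * (u - x) ^+ 2 <= (1 / 2) ^+ 2 * (u - x) ^+ 2.
  by rewrite ler_wpM2r// sqr_ge0.
have h3 : 0 <= (u + x) ^+ 2 by exact: sqr_ge0.
have h4 : (r * c) ^+ 2 * (u - x) ^+ 2 <= u ^+ 2 / 2 + x ^+ 2 / 2.
  apply: le_trans h2 _.
  have -> : (1 / 2) ^+ 2 * (u - x) ^+ 2 = u ^+ 2 / 2 + x ^+ 2 / 2 - (u + x) ^+ 2 / 4 by field.
  by rewrite gerBl divr_ge0.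
have := ler_wpM2l e0 h4.
have -> : - e * (u * u - r * c * (u - x) * (r * c * (u - x))) -
  0 * (u * (r * c * (u - x)) + r * c * (u - x) * u) =
  - e * u ^+ 2 + e * ((r * c) ^+ 2 * (u - x) ^+ 2) by ring.
lra.
Qed.

Section Observable.
Variables (F : Cx R -> Cx R) (A B : R).
Hypotheses (A0 : 0 <= A) (B0 : 0 <= B).
Hypothesis dF : holo_on Om F.
Hypothesis Fle : forall z, Om z -> cabs (F z) <= A * expR (B * cabs z).

Let D := be + B.
Let D0 : 0 <= D. Proof. exact: addr_ge0. Qed.
(** Here [g] stands for the kernel [G t x] at one fixed point and [F] for the initial datum. The
    real weight [exp(- e y^2)] is replaced by its entire extension, so that the whole integrand can
    leave the real axis. *)
Definition regularized (e : R) (z : Cx R) := cexp (toC (- e) * z ^+ 2) * (g z * F z).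

Lemma cdiff_regularized e u r : 0 <= r <= 1 -> cdiff (regularized e) (tilt c x u r).
Proof.
move=> hr; apply: derivable_cdiff; apply: derivableM.
  exact/cdiff_derivable/cdiff_gauss.
by apply: derivableM; [exact/dg/oOm|exact/dF/oOm].
Qed.

Lemma cabs_regularized e u r : 0 <= e -> 0 <= r <= 1 ->
  cabs (regularized e (tilt c x u r)) <= al * A *
  expR (- (e / 2) * u ^+ 2 + e / 2 * x ^+ 2 +
        (- (2 * a * (r * c)) * (u - x) ^+ 2) + D * (2 * `|u| + `|x|)).
Proof.
move=> e0 hr; rewrite /regularized cabsM (cabsM (g _)).
have h1 := cabs_gauss_tilt e u r e0 hr.
have h2 := gle _ (oOm u r hr); rewrite cabs_chirp_tilt in h2.
have h3 := Fle _ (oOm u r hr).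
have h4 : expR (be * cabs (tilt c x u r)) * expR (B * cabs (tilt c x u r)) <=
    expR (D * (2 * `|u| + `|x|)).
  rewrite -expRD -mulrDl ler_expR ler_wpM2l//; exact: cabs_tilt.
apply: le_trans (ler_pM (cabs_ge0 _) _ h1 (ler_pM (cabs_ge0 _) (cabs_ge0 _) h2 h3)) _.
  by rewrite mulr_ge0 ?cabs_ge0.
rewrite (expRD (_ + _) (D * _)) (expRD (_ + _) (- _ * (u - x) ^+ 2)).
set E1 := expR _; set E2 := expR _; set E3 := expR _ in h4 *.
set E4 := expR _ in h4 *; set E5 := expR _ in h4 *.
have -> : E1 * (E2 * (al * E3) * (A * E4)) = al * A * (E1 * E2) * (E3 * E4) by ring.
rewrite [leRHS]mulrA ler_wpM2l// !mulr_ge0 ?expR_ge0//.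
Qed.

(** Uniform in the angle [r] but not in [e]: the chirp is bounded by 1 and the regularizer absorbs
    the exponential growth. This is the decay that [contour_shift] asks for. *)
Lemma cabs_regularized_gauss e u r : 0 < e -> 0 <= r <= 1 ->
  cabs (regularized e (tilt c x u r)) <=
  al * A * expR (e / 2 * x ^+ 2 + 4 * D ^+ 2 / e + D * `|x|) * expR (- (e / 4) * u ^+ 2).
Proof.
move=> e0 hr; apply: le_trans (cabs_regularized _ _ _ (ltW e0) hr) _.
rewrite -[leRHS]mulrA -expRD ler_wpM2l ?mulr_ge0// ler_expR.
have /andP[r0 r1] := hr.
have h1 := gauss_linear_le e D u e0.
have h2 : 0 <= 2 * a * (r * c) * (u - x) ^+ 2.
  apply: mulr_ge0; last exact: sqr_ge0.
  by do ![apply: mulr_ge0 => //]; exact: ltW.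
move: h1 h2; rewrite mulNr; lra.
Qed.

(** Half of the Gaussian [exp(-2 a c (u - x)^2)] absorbs the growth
    [exp(D (2 |u| + |x|))]; this is the constant left over. *)
Definition tilt_majorant : R := al * A * expR (x ^+ 2 / 2 + D ^+ 2 / (a * c) + 3 * D * `|x|).

(** Uniform in [e], on the final line only: a dominating function for [e] tending to 0. In
    [tilt_majorant], [x^2 / 2] bounds the exponent of the regularizer, [D^2 / (a c)] comes from
    completing the square in [|u - x|], and [3 D |x|] from [2 |u| + |x| <= 2 |u - x| + 3 |x|]. *)
Lemma cabs_regularized_tilt e u : 0 <= e <= 1 ->
  cabs (regularized e (tilt c x u 1)) <=
  tilt_majorant * expR (- (a * c) * (u - x) ^+ 2).
Proof.
move=> /andP[e0 e1].
have h11 : 0 <= (1 : R) <= 1 by rewrite lexx ler01.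
apply: le_trans (cabs_regularized _ _ _ e0 h11) _.
rewrite /tilt_majorant -[leRHS]mulrA -expRD ler_wpM2l ?mulr_ge0// ler_expR.
have ac : 0 < 4 * (a * c) by rewrite !mulr_gt0.
have h1 := gauss_linear_le (4 * (a * c)) (2 * D) (u - x) ac.
have h2 : `|u| <= `|u - x| + `|x| by rewrite -{1}(subrK x u) ler_normD.
have h3 : e * x ^+ 2 <= x ^+ 2 by rewrite -[leRHS]mul1r ler_wpM2r ?sqr_ge0.
have h4 : 0 <= e * u ^+ 2 by rewrite mulr_ge0 ?sqr_ge0.
have h5 := ler_wpM2l D0 h2.
have E : 4 * (2 * D) ^+ 2 / (4 * (a * c)) = 4 * (D ^+ 2 / (a * c)).
  by field; rewrite !gt_eqF.
move: h1; rewrite E; clear E.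
have : 2 * D * `|u - x| <= a * c * (u - x) ^+ 2 + D ^+ 2 / (a * c).
  rewrite -subr_ge0.
  have -> : a * c * (u - x) ^+ 2 + D ^+ 2 / (a * c) - 2 * D * `|u - x| =
    (a * c * `|u - x| - D) ^+ 2 / (a * c).
    rewrite -(@real_normK _ (u - x)) ?num_real//; field; rewrite !gt_eqF//.
  by rewrite divr_ge0 ?sqr_ge0// mulr_ge0 ?ltW.
move=> h6 _; move: h3 h4 h5 h6; rewrite !mulNr mul1r; lra.
Qed.

Definition tilted_integral : Cx R :=
  tilt_du c 1 * Cintegral setT (fun u => g (tilt c x u 1) * F (tilt c x u 1)).

Let r01 : 0 <= (1 : R) <= 1. Proof. by rewrite lexx ler01. Qed.

Lemma integrable_tilt_majorant : mu.-integrable setT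
  (EFin \o (fun u => tilt_majorant * expR (- (a * c) * (u - x) ^+ 2))).
Proof. by apply: integrableMl_cst; apply: integrable_gaussian; rewrite mulr_gt0. Qed.

Lemma cabs_tilted_integrand u :
  cabs (g (tilt c x u 1) * F (tilt c x u 1)) <=
  tilt_majorant * expR (- (a * c) * (u - x) ^+ 2).
Proof.
have := cabs_regularized_tilt 0 u; rewrite lexx ler01 => /(_ isT).
rewrite /regularized oppr0; congr (cabs _ <= _).
have -> : toC 0 * tilt c x u 1 ^+ 2 = toC 0.
  by apply: complexP; rewrite !reimE; ring.
rewrite cexp_toC expR0; exact: mul1r.
Qed.

Lemma continuous_tilted_integrand :
  continuous (fun u => g (tilt c x u 1) * F (tilt c x u 1)).
Proof.
move=> u; apply: (cdiff_tilt_l c x (fun z => g z * F z)).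
by apply/derivable_cdiff/derivableM; [exact/dg/oOm|exact/dF/oOm].
Qed.

Lemma Cintegrable_tilted :
  Cintegrable setT (fun u => g (tilt c x u 1) * F (tilt c x u 1)).
Proof.
apply: Cintegrable_continuous integrable_tilt_majorant _.
  exact: continuous_tilted_integrand.
exact: cabs_tilted_integrand.
Qed.

(** The 4 is [cabs (tilt_du c 1) <= 2] times the 2 of [le_cabs_Cintegral]. *)
Lemma cabs_tilted_integral :
  cabs tilted_integral <= 4 * (tilt_majorant * Num.sqrt (pi / (a * c))).
Proof.
have h : cabs (tilt_du c 1) <= 2.
  apply: le_trans (cabs_le_reim _) _; rewrite /= normr1 mul1r (ger0_norm (ltW c0)).
  by apply: le_trans (lerD (lexx 1) c2) _; lra.
rewrite /tilted_integral cabsM.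
have := @le_cabs_Cintegral _ setT _ _ measurableT Cintegrable_tilted integrable_tilt_majorant
  (fun u _ => cabs_tilted_integrand u).
rewrite RintegralZl//; last by apply: integrable_gaussian; rewrite mulr_gt0.
rewrite Rintegral_gaussian; last by rewrite mulr_gt0.
move=> h'; apply: le_trans (ler_pM (cabs_ge0 _) (cabs_ge0 _) h h') _; lra.
Qed.

Lemma Cint_regularized e : 0 < e ->
  Cint (fun y => toC (expR (- e * y ^+ 2)) * g (toC y) * F (toC y)) =
  tilt_du c 1 * Cintegral setT (fun u => regularized e (tilt c x u 1)).
Proof.
move=> e0; have e4 : 0 < e / 4 by rewrite divr_gt0.
rewrite -(@contour_shift _ c x (regularized e)
  (al * A * expR (e / 2 * x ^+ 2 + 4 * D ^+ 2 / e + D * `|x|)) (e / 4) e4); last first.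
- by move=> u r hr; exact: cabs_regularized_gauss.
- by move=> u r hr; exact: cdiff_regularized.
- by rewrite mulr_ge0 ?expR_ge0// mulr_ge0.
apply: eq_Cintegral => y _; rewrite /regularized -mulrA; congr (_ * _).
rewrite -cexp_toC; congr cexp.
by apply: complexP; rewrite expr2 !reimE /=; ring.
Qed.

Lemma cvg_regularized : (fun e : R =>
    Cint (fun y => toC (expR (- e * y ^+ 2)) * g (toC y) * F (toC y))) @ 0^'+
  --> tilted_integral.
Proof.
(* Truncation at 1 keeps the parameter in the range of [cabs_regularized_tilt] for every index of a
   sequence, and changes nothing near 0. *)
pose J e := Cintegral setT (fun u => regularized (Num.min e 1) (tilt c x u 1)).
suff JJ : J @ 0^'+ --> Cintegral setT (fun u => g (tilt c x u 1) * F (tilt c x u 1)).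
  have JM : (fun e => tilt_du c 1 * J e) @ 0^'+ --> tilted_integral.
    exact: (cvgM (cvg_cst _) JJ).
  apply: cvg_trans JM; apply: near_eq_cvg.
  near=> e.
  have e0 : 0 < e by near: e; exact: nbhs_right_gt.
  have e1 : e <= 1 by near: e; apply: nbhs_right_le.
  by rewrite Cint_regularized// /J min_l.
(* Dominated convergence is sequential; [cvg_at_rightP] returns to the one-sided limit at the
   end. *)
have key (un : nat -> R) : (forall n, 0 < un n) -> un n @[n --> \oo] --> 0 ->
    J (un n) @[n --> \oo] --> Cintegral setT (fun u => g (tilt c x u 1) * F (tilt c x u 1)).
  move=> u0 uc; apply: cvg_Cintegral_dominated integrable_tilt_majorant _.
  - by move=> n u; apply: cdiff_tilt_l; exact: cdiff_regularized.
  - exact: continuous_tilted_integrand.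
  - move=> u; rewrite -[X in _ --> X]mul1r; apply: cvgM; last exact: cvg_cst.
    have mc : Num.min (un n) 1 @[n --> \oo] --> 0.
      have un1 : \forall n \near \oo, un n < 1 by exact: (cvgr_lt 0 uc 1 ltr01).
      apply: cvg_trans uc; apply: near_eq_cvg.
      move: un1; apply: filterS => n {}un1.
      by rewrite min_l// ltW.
    have zc : toC (- Num.min (un n) 1) * tilt c x u 1 ^+ 2 @[n --> \oo] --> (0 : Cx R).
      rewrite -(mul0r (tilt c x u 1 ^+ 2)); apply: cvgM; last exact: cvg_cst.
      apply: cvgC_reim => /=; last exact: cvg_cst.
      by rewrite -oppr0; exact: cvgN.
    have -> : 1 = cexp 0 :> Cx R.
      by rewrite cexpE /= expR0 cos0 sin0 mulr1 mulr0.
    by apply: cvg_comp zc _; exact/cdiff_continuous/cdiff_cexp.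
  - move=> n u; apply: cabs_regularized_tilt.
    by rewrite le_min ler01 (ltW (u0 n))//= ge_min lexx orbT.
apply: cvgC_reim; apply/cvg_at_rightP => un [u0 uc]; apply: (cvg_comp _ _ (key un u0 uc)).
  exact: continuous_reC.
exact: continuous_imC.
Unshelve. all: by end_near. Qed.

End Observable.
End RotatedKernel.

(** * Linearity and uniform bounds *)

Section Superposition.
Context {R : realType}.
Variable Om : set (Cx R).
Implicit Types F H g : Cx R -> Cx R.

Definition observable F := holo_on Om F /\ exists A B : R,
  [/\ 0 <= A, 0 <= B & forall z, Om z -> cabs (F z) <= A * expR (B * cabs z)].

Lemma observable0 : observable (fun=> 0).
Proof.
split; first by move=> z _; exact: derivable_cst.
by exists 0, 0; split=> // z _; rewrite cabs0 mul0r.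
Qed.

Lemma observable_axpy F H (k : Cx R) : observable F -> observable H ->
  observable (fun z => F z + k * H z).
Proof.
move=> [dF [A1 [B1 [A10 B10 F1]]]] [dH [A2 [B2 [A20 B20 H2]]]]; split.
  move=> z Oz; apply: derivableD; first exact: dF.
  by apply: derivableM; [exact: derivable_cst|exact: dH].
exists (A1 + cabs k * A2), (B1 + B2); split.
- by rewrite addr_ge0// mulr_ge0// cabs_ge0.
- by rewrite addr_ge0.
move=> z Oz; apply: le_trans (le_cabsD _ _) _; rewrite cabsM [leRHS]mulrDl.
have mono (B B' : R) : B <= B' -> expR (B * cabs z) <= expR (B' * cabs z).
  by move=> BB; rewrite ler_expR ler_wpM2r// cabs_ge0.
apply: lerD.
  by apply: le_trans (F1 _ Oz) _; rewrite ler_wpM2l// mono// lerDl.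
rewrite -mulrA ler_wpM2l ?cabs_ge0//.
by apply: le_trans (H2 _ Oz) _; rewrite ler_wpM2l// mono// lerDr.
Qed.

(** Bundles what the rotation requires of the kernel at one point [(t, x)]: slope [c], chirp rate
    [a], and growth constants [al], [be] for the amplitude. *)
Record rotatable (c x a al be : R) g : Prop := Rotatable {
  rot_c0 : 0 < c; rot_c2 : c <= 1 / 2; rot_a0 : 0 < a;
  rot_al0 : 0 <= al; rot_be0 : 0 <= be;
  rot_tilt : forall u r, 0 <= r <= 1 -> Om (tilt c x u r);
  rot_holo : holo_on Om g;
  rot_le : forall z, Om z -> cabs (g z) <=
    cabs (cexp ('i%C * toC a * (z - toC x) ^+ 2)) * (al * expR (be * cabs z)) }.

(** [lim] is total, so [Psi] has its intended meaning only where the regularized integrals converge;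
    here they do, and an absolutely convergent integral takes the place of the limit. *)
Lemma Psi_tilted (G : R -> R -> Cx R -> Cx R) c a al be t x F : t != 0 ->
  rotatable c x a al be (G t x) -> observable F ->
  Psi G F t x = tilted_integral c x (G t x) F.
Proof.
move=> t0 [h1 h2 h3 h4 h5 h6 h7 h8] [dF [A [B [hA hB FAB]]]].
rewrite /Psi (negbTE t0); apply: cvg_lim; first exact: norm_hausdorff.
exact: (cvg_regularized c x a al be Om _ h1 h2 h3 h4 h5 h6 h7 h8 F A B hA hB dF FAB).
Qed.

Lemma tilted_integral_axpy c x a al be g F H (k : Cx R) :
  rotatable c x a al be g -> observable F -> observable H ->
  tilted_integral c x g (fun z => F z + k * H z) =
  tilted_integral c x g F + k * tilted_integral c x g H.
Proof.
move=> [h1 h2 h3 h4 h5 h6 h7 h8].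
move=> [dF [A1 [B1 [A10 B10 F1]]]] [dH [A2 [B2 [A20 B20 H2]]]].
have iF := Cintegrable_tilted c x a al be Om g h1 h2 h3 h4 h5 h6 h7 h8 F A1 B1 A10 B10 dF F1.
have iH := Cintegrable_tilted c x a al be Om g h1 h2 h3 h4 h5 h6 h7 h8 H A2 B2 A20 B20 dH H2.
rewrite /tilted_integral mulrCA -mulrDr -[k * Cintegral _ _]CintegralZ// -CintegralD//; last exact: CintegrableZ.
by congr (_ * _); apply: eq_Cintegral => u _; ring.
Qed.

Definition evolvable (G : R -> R -> Cx R -> Cx R) (t x : R) :=
  t = 0 \/ t != 0 /\ exists c a al be, rotatable c x a al be (G t x).

Lemma Psi_axpy G t x F H (k : Cx R) : evolvable G t x -> observable F -> observable H ->
  Psi G (fun z => F z + k * H z) t x = Psi G F t x + k * Psi G H t x.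
Proof.
move=> [->|[t0 [c [a [al [be rot]]]]]] oF oH; first by rewrite /Psi eqxx.
rewrite !(Psi_tilted G c a al be)//; last exact: observable_axpy.
exact: (tilted_integral_axpy c x a al be).
Qed.

Lemma observable_sum (k : nat -> Cx R) (f : nat -> Cx R -> Cx R) m :
  (forall l, (l < m)%N -> observable (f l)) ->
  observable (fun z => \sum_(l < m) k l * f l z).
Proof.
elim: m => [_|m IH of_].
  by under eq_fun do rewrite big_ord0; exact: observable0.
under eq_fun do rewrite big_ord_recr/=.
apply: observable_axpy; last exact: of_.
by apply: IH => l lm; apply: of_; rewrite ltnS ltnW.
Qed.

Lemma Psi_sum G t x (k : nat -> Cx R) (f : nat -> Cx R -> Cx R) m : evolvable G t x ->
  (forall l, (l < m)%N -> observable (f l)) ->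
  Psi G (fun z => \sum_(l < m) k l * f l z) t x = \sum_(l < m) k l * Psi G (f l) t x.
Proof.
move=> ev; elim: m => [_|m IH of_].
  rewrite big_ord0; under eq_fun do rewrite big_ord0.
  (* The zero function is [0 + (-1) * 0], whence its evolution equals [Psi 0 - Psi 0]. *)
  have := Psi_axpy G t x (fun=> 0) (fun=> 0) (-1) ev observable0 observable0.
  rewrite [_ * Psi _ _ _ _]mulN1r subrr => E; rewrite -[RHS]E; congr (Psi G _ t x).
  by apply/funext => z; rewrite mulr0 addr0.
have ofm l : (l < m)%N -> observable (f l) by move=> lm; apply: of_; rewrite ltnS ltnW.
rewrite big_ord_recr/= -IH//; under eq_fun do rewrite big_ord_recr/=.
by apply: Psi_axpy => //; [exact: observable_sum|exact: of_].
Qed.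

End Superposition.

(** * Bounds on compact subsets of the space-time domain *)

Section CompactBounds.
Context {R : realType}.
Implicit Types K : set (R * R).

Lemma compact_continuous_bound K (f : R * R -> R) : compact K ->
  {within K, continuous f} -> exists2 M : R, 0 <= M & forall p, K p -> `|f p| <= M.
Proof.
move=> cK cf.
have /compact_bounded[M [_ hM]] := continuous_compact cf cK.
exists (`|M| + 1); first by rewrite addr_ge0.
move=> p Kp; apply: hM; last by exists p.
by rewrite ltr_pwDr// ler_norm.
Qed.

(** A family of one interval inside [[t / 2, t2]] suffices; [t2] leaves room to the right of [t]
    below a finite or infinite [T]. *)
Lemma abs_cont_continuous (T : \bar R) (a : R -> R) (t : R) : tint T t ->
  abs_cont (tint T) (fun t => toC (a t)) -> {for t, continuous a}.
Proof.
move=> [t0 tT] ac.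
have [t2 tt2 t2T] : exists2 t2 : R, t < t2 & (t2%:E < T)%E.
  case: T tT {ac} => [T| |] //.
    rewrite lte_fin => tT; exists ((t + T) / 2); first by rewrite midf_lt.
    by rewrite lte_fin midf_lt.
  by move=> _; exists (t + 1); rewrite ?ltry// ltrDl.
have th : t / 2 < t by rewrite ltr_pdivrMr// ltr_pMr// ltr1n.
have sub : `[t / 2, t2] `<=` tint T.
  move=> s /=; rewrite in_itv/= => /andP[s1 s2]; split.
    by apply: lt_le_trans s1; rewrite divr_gt0.
  by apply: le_lt_trans t2T; rewrite lee_fin.
have {}ac := ac _ _ (ltW (lt_trans th tt2)) sub.
apply/(@cvgrPdist_lt _ _ _ (nbhs t)) => e e0; have [d [d0 hd]] := ac _ e0.
have two u v : t / 2 <= u -> u <= v -> v <= t2 -> v - u < d -> `|a v - a u| < e.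
  move=> h1 h2 h3 h4; have := hd 1%N (fun=> u) (fun=> v).
  rewrite !big_ord1 => /(_ _ _ h4).
  have -> : toC (a v) - toC (a u) = toC (a v - a u).
    by apply: complexP; rewrite !reimE; ring.
  rewrite cabs_toC; apply; first by [].
  by move=> i j; rewrite (ord1 i) (ord1 j) eqxx.
near=> s.
have s1 : t / 2 <= s by apply: ltW; near: s; exact: lt_nbhsr.
have s2 : s <= t2 by apply: ltW; near: s; exact: lt_nbhsl.
have : `|t - s| < d.
  near: s; have : nbhs t (ball t d) by exact: nbhsx_ballx.
  by apply: filterS => s; rewrite -ball_normE.
have [st|ts] := leP s t.
  by rewrite ger0_norm ?subr_ge0// => h; apply: two => //; exact: ltW.
rewrite distrC ger0_norm ?subr_ge0 ?(ltW ts)// => h.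
by rewrite distrC; apply: two => //; exact: ltW.
Unshelve. all: by end_near. Qed.

(** For [t < d] the divergence at [0] gives [a t >= 1]. The part of [K] with [t >= d] is compact
    inside the open time interval, where [1 / a] is continuous, hence bounded. *)
Lemma rate_lower_bound (T : \bar R) (a : R -> R) K :
  abs_cont (tint T) (fun t => toC (a t)) -> (forall t, tint T t -> 0 < a t) ->
  a t @[t --> 0^'+] --> +oo -> compact K -> K `<=` dom0 T ->
  exists2 m : R, 0 < m & forall p, K p -> 0 < p.1 -> m <= a p.1.
Proof.
move=> ac ap ainf cK KT.
have [d d0 hd] : exists2 d : R, 0 < d & forall t, 0 < t -> t < d -> 1 <= a t.
  have /cvgryPge/(_ 1) := ainf; case=> d /= d0 hd; exists d => // t t0 td.
  by apply: hd => //=; rewrite sub0r normrN gtr0_norm.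
have tK p : K p -> 0 < p.1 -> tint T p.1 by move=> /KT[_ pT] p0; split.
have cK' : compact (K `&` [set p | d <= p.1]).
  apply: compact_closedI => //.
  apply: (@closed_comp _ _ (fun p : R * R => p.1) [set t | d <= t]).
    by move=> p _; exact: cvg_fst.
  exact: closed_ge.
have cf : {within K `&` [set p | d <= p.1], continuous (fun p => (a p.1)^-1)}.
  apply: continuous_in_subspaceT => p /set_mem[Kp /= dp].
  have p0 : 0 < p.1 := lt_le_trans d0 dp.
  have pT := tK _ Kp p0.
  apply: (@continuous_comp _ _ _ (fun p : R * R => a p.1) (@GRing.inv R)).
    apply: (@continuous_comp _ _ _ (@fst R R) a); first exact: cvg_fst.
    exact: abs_cont_continuous ac.
  by apply: inv_continuous; rewrite gt_eqF// ap.
have [M M0 hM] := compact_continuous_bound _ _ cK' cf.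
exists (Num.min 1 (M + 1)^-1); first by rewrite lt_min ltr01 invr_gt0 ltr_wpDl.
move=> p Kp p0; rewrite ge_min; have [pd|dp] := ltP p.1 d; first by rewrite hd.
apply/orP; right; have app := ap _ (tK _ Kp p0).
rewrite -[leRHS]invrK lef_pV2 ?posrE ?invr_gt0 ?ltr_wpDl//.
apply: le_trans (ler_norm _) _; apply: le_trans (hM p (conj Kp dp)) _.
by rewrite lerDl.
Qed.

End CompactBounds.

(** * Uniform stability of the evolution up to the initial time *)

Section Stability.
Context {R : realType}.

(** The order of quantifiers is the point: slope and bounds depend on [K] alone, while [a] and [al]
    vary with [(t, x)] and may blow up as [t] tends to 0, tied by [al <= M * sqrt a]. *)
Lemma kernel_rotatable (T : \bar R) V (alpha : R) (Om : set (Cx R))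
    (G : R -> R -> Cx R -> Cx R) (K : set (R * R)) :
  standing_G T V alpha Om G -> compact K -> K `<=` dom0 T ->
  exists X c m M b : R, [/\ 0 <= X, 0 < m, 0 <= M, 0 <= b &
    forall t x, K (t, x) -> `|x| <= X /\
      (t != 0 -> exists a al, [/\ m <= a, al <= M * Num.sqrt a &
        rotatable Om c x a al b (G t x)])] /\ 0 < c.
Proof.
move=> [T0 [al0 [alpi [oOm [SOm [dG [_]]]]]]].
move=> [a [Gt [A0 [B0 [A1 [B1 [ac [apos [ainf [Gfac [AB0 [cA0 [cB0]]]]]]]]]]]]].
move=> [[gA [cgA gAE]] [[gB [cgB gBE]] _]] cK KT.
have [m m0 hm] := rate_lower_bound T a K ac apos ainf cK KT.
have [X X0 hX] := compact_continuous_bound K (@snd R R) cK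
  (continuous_subspaceT (fun p => cvg_snd)).
have [M M0 hM] := compact_continuous_bound K gA cK (continuous_subspaceW KT cgA).
have [b b0 hb] := compact_continuous_bound K gB cK (continuous_subspaceW KT cgB).
have [c [/andP[c0 c2] hc]] := tilt_mem alpha Om al0 alpi oOm SOm X X0.
exists X, c, m, M, b; split=> //; split=> // t x Ktx.
have xX : `|x| <= X := hX _ Ktx; split=> // t0.
have [/= t_ge0 tT] := KT _ Ktx.
have tp : 0 < t by rewrite lt_neqAle eq_sym t0.
have tIn : tint T t by split.
have [A0p B0p] := AB0 t x tIn.
exists (a t), (A0 t x); split.
- exact: (hm (t, x)).
- rewrite -ler_pdivrMr ?sqrtr_gt0 ?apos//.
  rewrite -[leLHS](gAE (t, x) tIn); apply: le_trans (hM _ Ktx); exact: ler_norm.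
- split=> //; first exact: apos.
  + by move=> u r hr; apply: hc.
  + exact: dG.
  + move=> z Oz; have [-> Gtle] := Gfac t x z tIn Oz.
    rewrite cabsM ler_wpM2l ?cabs_ge0//; apply: le_trans Gtle _.
    rewrite ler_wpM2l// ler_expR ler_wpM2r ?cabs_ge0//.
    by rewrite -[leLHS](gBE (t, x) tIn); apply: le_trans (hb _ Ktx); exact: ler_norm.
Qed.

Lemma Psi_stable (T : \bar R) V (alpha : R) (Om : set (Cx R))
    (G : R -> R -> Cx R -> Cx R) (K : set (R * R)) (C0 : R) :
  standing_G T V alpha Om G -> compact K -> K `<=` dom0 T -> 0 <= C0 ->
  (forall t x, K (t, x) -> evolvable Om G t x) /\
  exists2 L : R, 0 < L & forall (F : Cx R -> Cx R) e, 0 <= e -> holo_on Om F ->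
    (forall z, Om z -> cabs (F z) <= e * expR (C0 * cabs z)) ->
    forall t x, K (t, x) -> cabs (Psi G F t x) <= e * L.
Proof.
move=> sG cK KT C00.
have [X [c [m [M [b [[X0 m0 M0 b0 hK] c0]]]]]] := kernel_rotatable _ _ _ _ _ _ sG cK KT.
split.
  move=> t x /hK[_ hr]; have [->|t0] := eqVneq t 0; [by left|right; split=> //].
  by have [a [al [_ _ rot]]] := hr t0; exists c, a, al, b.
have D0 : 0 <= b + C0 by rewrite addr_ge0.
(* The exponential of [tilt_majorant] at its worst over [K]: [a] replaced by its lower bound [m],
   [|x|] by [X]. *)
pose E := expR (X ^+ 2 / 2 + (b + C0) ^+ 2 / (m * c) + 3 * (b + C0) * X).
pose L1 := 4 * (M * Num.sqrt (pi / c) * E).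
have L10 : 0 <= L1 by rewrite !mulr_ge0 ?sqrtr_ge0 ?expR_ge0.
(* [L1] handles positive times; [expR (C0 * X)] handles [t = 0], where [Psi] is evaluation at
   [x]. *)
exists (L1 + expR (C0 * X)); first by rewrite ltr_wpDl// expR_gt0.
move=> F e e0 dF Fe t x Ktx; have [xX hr] := hK t x Ktx.
have [t0|t0] := eqVneq t 0.
  have Ox : Om (toC x).
    have [_ [al0 [alpi [_ [SOm _]]]]] := sG; apply: SOm.
    exact: double_sector_real.
  rewrite /Psi t0 eqxx; apply: le_trans (Fe _ Ox) _; rewrite ler_wpM2l//.
  by rewrite cabs_toC ler_wpDl// ler_expR ler_wpM2l.
have [a [al [ma alM rot]]] := hr t0.
have oF : observable Om F by split=> //; exists e, C0; split.
rewrite (Psi_tilted Om G c a al b)//.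
have [h1 h2 a0 al0 h5 h6 h7 h8] := rot.
apply: le_trans (cabs_tilted_integral c x a al b Om _ h1 h2 a0 al0 h5 h6 h7 h8
  F e C0 e0 C00 dF Fe) _.
apply: (@le_trans _ _ (e * L1)); last by rewrite ler_wpM2l// lerDl expR_ge0.
have -> : e * L1 = 4 * (e * (M * Num.sqrt (pi / c) * E)) by rewrite /L1; ring.
rewrite ler_wpM2l// /tilt_majorant.
have pc : 0 <= pi / c by rewrite divr_ge0 ?pi_ge0 ?ltW.
(* The decisive cancellation: the Gaussian integral contributes [1 / sqrt a] against an amplitude of
   at most [M * sqrt a], so the bound survives [t] tending to 0. *)
have alS : al * Num.sqrt (pi / (a * c)) <= M * Num.sqrt (pi / c).
  have -> : pi / (a * c) = pi / c / a by field; rewrite !gt_eqF.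
  have -> : Num.sqrt (pi / c / a) = (Num.sqrt a)^-1 * Num.sqrt (pi / c).
    by rewrite mulrC sqrtrM ?invr_ge0 ?ltW// sqrtrV// ltW.
  rewrite mulrA; apply: ler_wpM2r; first exact: sqrtr_ge0.
  by rewrite ler_pdivrMr// sqrtr_gt0.
have eE : expR (x ^+ 2 / 2 + (b + C0) ^+ 2 / (a * c) + 3 * (b + C0) * `|x|) <= E.
  rewrite ler_expR; apply: lerD; [apply: lerD|].
  + by rewrite ler_wpM2r// -(@real_normK _ x) ?num_real// ler_pXn2r ?nnegrE.
  + rewrite ler_wpM2l ?sqr_ge0// lef_pV2 ?posrE ?mulr_gt0//.
    by rewrite ler_wpM2r// ltW.
  + by rewrite ler_wpM2l// mulr_ge0.
set E1 := expR _ in eE *.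
have -> : al * e * E1 * Num.sqrt (pi / (a * c)) =
  e * (al * Num.sqrt (pi / (a * c)) * E1) by ring.
rewrite ler_wpM2l// ler_pM ?expR_ge0// mulr_ge0// sqrtr_ge0.
Qed.

Lemma cvg_sup_weighted (Om : set (Cx R)) (F : nat -> Cx R -> Cx R) (C0 : R) :
  ereal_sup [set (cabs (F n z) * expR (- C0 * cabs z))%:E | z in Om]
    @[n --> \oo] --> 0%E ->
  forall e : R, 0 < e -> \forall n \near \oo, forall z, Om z ->
    cabs (F n z) <= e * expR (C0 * cabs z).
Proof.
move=> sup0 e e0.
have : \forall n \near \oo,
    (ereal_sup [set (cabs (F n z) * expR (- C0 * cabs z))%:E | z in Om] < e%:E)%E.
  have : nbhs (0%E : \bar R) [set y | (y < e%:E)%E].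
    by apply: open_nbhs_nbhs; split; [exact: open_ereal_lt_ereal|rewrite /= lte_fin].
  by move=> /sup0.
apply: filterS => n supe z Oz.
have : ((cabs (F n z) * expR (- C0 * cabs z))%:E < e%:E)%E.
  by apply: le_lt_trans supe; apply: ereal_sup_ubound; exists z.
rewrite lte_fin mulNr expRN ltr_pdivrMr ?expR_gt0//; exact: ltW.
Qed.

End Stability.

Theorem theorem4p5 (R : realType) (T : \bar R) (V : R -> R -> Cx R)
  (alpha : R) (Om : set (Cx R)) (G : R -> R -> Cx R -> Cx R)
  (U O : set (Cx R)) (phi : Cx R -> Cx R -> Cx R) (A B : Cx R -> R)
  (Cf kap : nat -> nat -> Cx R) (kappa : Cx R) (C0 : R) :
  standing_G T V alpha Om G ->
  U `<` O ->
  (forall k, O k -> holo_on Om (phi k)) ->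
  (forall k z, O k -> Om z -> cabs (phi k z) <= A k * expR (B k * cabs z)) ->
  (forall k, O k -> 0 <= A k /\ 0 <= B k) ->
  {within O, continuous A} -> {within O, continuous B} ->
  (forall n l, (l <= n)%N -> U (kap n l)) ->
  O kappa -> ~ U kappa -> 0 <= C0 ->
  ereal_sup [set (cabs (Fseq Cf kap phi n z - phi kappa z)
                   * expR (- C0 * cabs z))%:E | z in Om]
    @[n --> \oo] --> 0%E ->
  forall K : set (R * R), compact K -> K `<=` dom0 T ->
    unif_cvg_on K (fun n p => Psi G (Fseq Cf kap phi n) p.1 p.2)
                  (fun p => Psi G (phi kappa) p.1 p.2) /\
    unif_cvg_on K (fun n p => \sum_(l < n.+1) Cf n l * Psi G (phi (kap n l)) p.1 p.2)
                  (fun p => Psi G (phi kappa) p.1 p.2).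
Proof.
move=> sG [UO _] dphi phi_le AB0 _ _ kapU Okappa _ C00 sup0 K cK KT.
have [ev [L L0 stab]] := Psi_stable _ _ _ _ _ _ _ sG cK KT C00.
have obs k : O k -> observable Om (phi k).
  move=> Ok; split; first exact: dphi.
  have [Ak Bk] := AB0 _ Ok.
  by exists (A k), (B k); split=> // z; exact: phi_le.
have obsn n l : (l < n.+1)%N -> observable Om (phi (kap n l)).
  by move=> ln; apply/obs/UO/kapU.
have obsF n : observable Om (Fseq Cf kap phi n).
  by apply: (observable_sum Om (Cf n) (fun l => phi (kap n l))) => l; exact: obsn.
have cvF : unif_cvg_on K (fun n p => Psi G (Fseq Cf kap phi n) p.1 p.2)
                  (fun p => Psi G (phi kappa) p.1 p.2).
  (* Half of [e / L], because the stability bound is not strict and the conclusion is. *)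
  move=> e e0; have eL : 0 < e / (2 * L) by rewrite divr_gt0// mulr_gt0.
  have := cvg_sup_weighted Om (fun n z => Fseq Cf kap phi n z - phi kappa z) C0 sup0 _ eL.
  apply: filterS => n Fn [t x] Kp /=.
  pose H z := Fseq Cf kap phi n z + (-1) * phi kappa z.
  have oH : observable Om H by apply: observable_axpy; [exact: obsF|exact: obs].
  have -> : Psi G (Fseq Cf kap phi n) t x - Psi G (phi kappa) t x = Psi G H t x.
    by rewrite (Psi_axpy Om) ?mulN1r//; [exact: ev|exact: obs].
  apply: (@le_lt_trans _ _ (e / (2 * L) * L)).
    apply: stab => //; [exact: ltW|by case: oH|].
    by move=> z Oz; rewrite /H mulN1r; exact: Fn.
  have -> : e / (2 * L) * L = e / 2 by field; rewrite gt_eqF.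
  by rewrite ltr_pdivrMr// ltr_pMr// ltr1n.
(* By linearity the two sequences coincide at every point of [K], so the second limit is the
   first. *)
split=> // e e0; apply: filterS (cvF e e0) => n Fn [t x] Kp /=.
rewrite -(Psi_sum Om G t x (Cf n) (fun l => phi (kap n l)))//; first exact: Fn (t, x) Kp.
  exact: ev.
by move=> l; exact: obsn.
Qed.
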